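(* Let $\mathbf P_{\mathcal N}$ denote the standard Gaussian distribution on $\mathbf R$ and let $\mathcal H$ be a class of functions included in $\operatorname{Lip}_1$. For any $F:E_A\to\mathbf R$ such that $F\in\mathbf D$ (the domain of $D$) and $\mathbf E[F]=0$, $$\kappa_{\mathcal H}(\mathbf P_{\mathcal N},\mathbf P_F)\le\sup_{\psi\in\operatorname{Lip}_2}\mathbf E\left[\psi(F)-\sum_{a\in A}\psi\big(F(X'_{\neg a})\big)\,D_aF\,(-D_aL^{-1}F)\right]$$ $$\qquad+\sum_{a\in A}\mathbf E\left[\int_{E_a}\big(F-F(X_{A\setminus\{a\}};x)\big)^2d\mathbf P_a(x)\;|D_aL^{-1}F|\right],$$ where $X'_{\neg a}$ denotes $X_A$ with its $a$-th coordinate replaced by $X'_a$.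
   Context: $A$ is an at most countable set, $(E_a,\mathcal E_a,\mathbf P_a)_{a\in A}$ are Polish spaces with probability measures, $E_A=\prod_{a\in A}E_a$ carries the product $\sigma$-field and the product measure $\otimes_{a\in A}\mathbf P_a$; $X_A=(X_a)_{a\in A}$ are the coordinate random variables and $F$ is identified with $F(X_A)$. For each $a$, $X'_a$ is an independent copy of $X_a$, independent of $X_A$; $\mathbf E$ is the expectation over all these variables. $F(X_{A\setminus\{a\}};x)$ is $F$ evaluated at $X_A$ with its $a$-th coordinate replaced by $x$. The gradient is $D_aF=F-\int_{E_a}F(X_{A\setminus\{a\}};x)\,d\mathbf P_a(x)$. $\mathbf D$ is the closure of the cylindrical random variables (elements of $L^2(E_A)$ depending on finitely many coordinates) for the norm $(\mathbf E[F^2]+\sum_a\mathbf E[|D_aF|^2])^{1/2}$. The divergence $\delta$ is the adjoint of $D$ (from $L^2(E_A)$ into the space of families $(U_a)_{a\in A}$ with $\sum_a\mathbf E[U_a^2]<\infty$) and $L=-\delta D$, formally $LF=-\sum_aD_aF$. For centered $F\in L^2(E_A)$, $L^{-1}F$ is the unique centered $G\in\mathbf D$ with $LG=F$, i.e. $\sum_a\mathbf E[D_aG\,D_aH]=-\mathbf E[FH]$ for all $H\in\mathbf D$. $\operatorname{Lip}_r$ is the set of $\varphi:\mathbf R\to\mathbf R$ with $|\varphi(x)-\varphi(y)|\le r|x-y|$ for all $x,y$. For probability measures $\mu,\nu$ on $\mathbf R$, $\kappa_{\mathcal H}(\mu,\nu)=\sup_{\varphi\in\mathcal H}|\int\varphi\,d\mu-\int\varphi\,d\nu|$.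 $\mathbf P_F$ is the law of $F$. *)

(* Defs.v *)
From HB Require Import structures.
From mathcomp Require Import all_boot all_order all_algebra finmap.
From mathcomp Require Import all_classical all_reals all_analysis.

Set Implicit Arguments.
Unset Strict Implicit.
Unset Printing Implicit Defensive.

Import Order.TTheory GRing.Theory Num.Theory.
Import numFieldNormedType.Exports.

Local Open Scope classical_set_scope.
Local Open Scope ring_scope.

Definition polish (R : realType) (T : topologicalType) : Prop :=
  (exists2 S : set T, countable S & dense S) /\
  exists dist : T -> T -> R,
    [/\ forall x y, (dist x y = 0) <-> (x = y),
        forall x y, dist x y = dist y x,
        forall x y z, dist x z <= dist x y + dist y z,
        forall x (U : set T),
          nbhs x U <-> exists2 e : R, 0 < e & [set y | dist x y < e] `<=` U
      & forall u : nat -> T,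
          (forall e : R, 0 < e -> exists N, forall m n,
             (N <= m)%N -> (N <= n)%N -> dist (u m) (u n) < e) ->
          exists l : T, u @ \oo --> l].

Definition borel (T : ptopologicalType) : measurableType (@open T).-sigma :=
  g_sigma_algebraType (@open T).

Section ProductSpace.
Context (A : countType) (d : A -> measure_display)
  (E : forall a, measurableType (d a)).

Definition coord_preimages : set (set (forall a, E a)) :=
  [set C | exists a, exists2 B : set (E a),
     measurable B & C = [set x | B (x a)]].

Definition prod_space : measurableType coord_preimages.-sigma :=
  g_sigma_algebraType coord_preimages.

(* The library has no infinite product of probability measures; this
   characterizes it among the probabilities on the product sigma-field. *)
Definition is_product_prob (R : realType) (P_ : forall a, probability (E a) R)
    (P : probability prod_space R) : Prop :=
  forall (J : {fset A}) (B : forall a, set (E a)),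
    (forall a, measurable (B a)) ->
    (P [set x | forall a, a \in J -> B a (x a)]
     = \prod_(a <- J) P_ a (B a))%E.

(* [upd x a y] is x with its a-th coordinate replaced by y. *)
Definition upd (x : prod_space) (a : A) (y : E a) : prod_space := dfwith x a y.

End ProductSpace.
Arguments upd {A d E} x a y.

Section Malliavin.
Context (R : realType) (A : countType) (d : A -> measure_display)
  (E : forall a, measurableType (d a)) (P_ : forall a, probability (E a) R)
  (P : probability (prod_space E) R).

(* Unordered sum over A; the intended value when f is absolutely summable. *)
Definition usum (f : A -> \bar R) : \bar R :=
  (\esum_(a in [set: A]) f^\+ a - \esum_(a in [set: A]) f^\- a)%E.

Definition grad (a : A) (F : prod_space E -> R) (x : prod_space E) : R :=
  F x - \int[P_ a]_y F (upd x a y).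

Definition cylindrical (F : prod_space E -> R) : Prop :=
  F \in Lfun P 2%:E /\
  exists J : {fset A}, forall x y : prod_space E,
    (forall a, a \in J -> x a = y a) -> F x = F y.

Definition Dnorm (F : prod_space E -> R) : \bar R :=
  sqrte ('E_P[fun x => (F x ^+ 2)%R] +
    \esum_(a in [set: A]) 'E_P[fun x => (`|grad a F x| ^+ 2)%R])%E.

Definition domD (F : prod_space E -> R) : Prop :=
  F \in Lfun P 2%:E /\
  forall e : R, 0 < e ->
    exists2 G, cylindrical G & (Dnorm (fun x => (F x - G x)%R) < e%:E)%E.

Definition L2_family (U : A -> prod_space E -> R) : Prop :=
  (forall a, U a \in Lfun P 2%:E) /\
  (\esum_(a in [set: A]) 'E_P[fun x => (U a x ^+ 2)%R] < +oo)%E.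

(* delta U = V almost surely: V represents the adjoint of D at U. *)
Definition is_divergence (U : A -> prod_space E -> R) (V : prod_space E -> R)
    : Prop :=
  [/\ L2_family U, V \in Lfun P 2%:E
    & forall H, domD H ->
        (usum (fun a => 'E_P[fun x => (grad a H x * U a x)%R])
         = 'E_P[fun x => (H x * V x)%R])%E].

(* L G = F almost surely, where L = - delta D *)
Definition is_L (G F : prod_space E -> R) : Prop :=
  is_divergence (fun a => grad a G) (fun x => - F x).

(* G is a version of L^{-1} F *)
Definition is_Linv (F G : prod_space E -> R) : Prop :=
  [/\ domD G, 'E_P[G]%E = 0%E & is_L G F].

End Malliavin.

Definition Lip (R : realType) (r : R) : set (R -> R) :=
  [set phi | forall x y, `|phi x - phi y| <= r * `|x - y|].

Definition kappa (R : realType) (H : set (R -> R))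
    (mu nu : probability (measurableTypeR R) R) : \bar R :=
  ereal_sup [set `|\int[mu]_x (phi x)%:E - \int[nu]_x (phi x)%:E|%E
            | phi in H].

(* Main.v *)
(** Stein's method.  For a 1-Lipschitz [phi] the equation
    [psi x - x * f x = phi x - \int phi dN] has a solution with [f' = psi] bounded
    and 2-Lipschitz, so the discrepancy is [E psi(F) - E (F f(F))].  Since
    [F = L (L^-1 F)] and [f(F)] is again in the domain of [D], integration by parts
    gives [E (F f(F)) = sum_a E (D_a f(F) * - D_a L^-1 F)].  Resampling the a-th
    coordinate, [D_a f(F)] is the conditional mean of [f(F) - f(F')], where [F']
    is [F] at [X'_{neg a}]; Taylor's formula at [F'] replaces it by
    [psi(F') * D_a F], up to an error at most [(F - F')^2] and up to a
    function of the other coordinates, to which [D_a L^-1 F] is orthogonal. *)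

Require Import Defs.
From HB Require Import structures.
From mathcomp Require Import all_boot all_order all_algebra finmap.
From mathcomp Require Import all_classical all_reals all_analysis.
From mathcomp Require Import measurable_realfun.
From mathcomp Require Import ring lra.

Set Implicit Arguments.
Unset Strict Implicit.
Unset Printing Implicit Defensive.

Import Order.TTheory GRing.Theory Num.Theory.
Import numFieldNormedType.Exports.

Local Open Scope classical_set_scope.
Local Open Scope ring_scope.

(** Two obstacles shape the argument. The first is the constant 2, reached although [phi] is only
    Lipschitz and [psi] need not be differentiable. It splits as 1 + 1 in
    [psi x = (phi x - m) + x * f x]: the second summand has derivative [f x + x * psi x], and
    bounding this by 1 is a sharp Mills' ratio estimate for the nondecreasing functions
    [x + (phi x - m)] and [x - (phi x - m)]. A 2-Lipschitz [psi] then gives a Taylor remainder with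
    coefficient exactly 1. The second is convergence. The supremum and the error sum may be
    infinite, and then the bound is trivial, but the other series must be absolutely summable before
    sums and expectations are exchanged. This is why [psi] has to be bounded, which a general member
    of [Lip 2] is not, and why the energies of [F], [f \o F] and [LinvF] have to be summable. All
    conditioning is Fubini's theorem on [P \x P_ a], together with the invariance of [P] under
    resampling one coordinate. *)

Section IntegralEFin.
Context {d} {T : measurableType d} {R : realType}.
Variable mu : {measure set T -> \bar R}.
Implicit Types f g : T -> R.

Lemma integral_EFinD f g : mu.-integrable setT (EFin \o f) ->
  mu.-integrable setT (EFin \o g) ->
  (\int[mu]_x (f x + g x)%:E = \int[mu]_x (f x)%:E + \int[mu]_x (g x)%:E)%E.
Proof. by move=> fi gi; rewrite -integralD. Qed.

Lemma integral_EFinB f g : mu.-integrable setT (EFin \o f) ->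
  mu.-integrable setT (EFin \o g) ->
  (\int[mu]_x (f x - g x)%:E = \int[mu]_x (f x)%:E - \int[mu]_x (g x)%:E)%E.
Proof. by move=> fi gi; rewrite -integralB_EFin. Qed.

Lemma integral_EFinN f : mu.-integrable setT (EFin \o f) ->
  (\int[mu]_x (- f x)%:E = - \int[mu]_x (f x)%:E)%E.
Proof.
move=> fi; rewrite -integralN//.
by rewrite fin_num_adde_defl// fin_numN; exact: integrable_neg_fin_num fi.
Qed.

Lemma integrable_EFinD f g : mu.-integrable setT (EFin \o f) ->
  mu.-integrable setT (EFin \o g) ->
  mu.-integrable setT (EFin \o (fun x => f x + g x)).
Proof. by move=> fi gi; apply: eq_integrable (integrableD _ fi gi). Qed.

Lemma integrable_EFinB f g : mu.-integrable setT (EFin \o f) ->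
  mu.-integrable setT (EFin \o g) ->
  mu.-integrable setT (EFin \o (fun x => f x - g x)).
Proof. by move=> fi gi; apply: eq_integrable (integrableB _ fi gi). Qed.

Lemma integrable_EFinZ (r : R) f : mu.-integrable setT (EFin \o f) ->
  mu.-integrable setT (EFin \o (fun x => r * f x)).
Proof. by move=> fi; apply: eq_integrable (integrableZl _ r fi). Qed.

Lemma integrable_le_norm f g : measurable_fun setT f ->
  (forall x, `|f x| <= g x) -> mu.-integrable setT (EFin \o g) ->
  mu.-integrable setT (EFin \o f).
Proof.
move=> mf fg; apply: le_integrable => //; first exact/measurable_EFinP.
by move=> x _ /=; rewrite lee_fin (le_trans (fg x))// ler_norm.
Qed.

End IntegralEFin.

Lemma Lip_continuous {R : realType} (r : R) (f : R -> R) : Lip r f -> continuous f.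
Proof.
move=> fr x; apply/cvgrPdist_le => /= e e0; near=> y.
rewrite (le_trans (fr _ _))//.
(* The constant is enlarged so that it can be divided by even when [r] is 0. *)
apply: (@le_trans _ _ ((`|r| + 1) * `|x - y|)).
  by rewrite ler_wpM2r// (le_trans (ler_norm r))// lerDl.
rewrite -ler_pdivlMl ?ltr_wpDl//; near: y.
apply: cvgr_dist_le; first exact: cvg_id.
by rewrite mulr_gt0// invr_gt0 ltr_wpDl.
Unshelve. all: by end_near. Qed.

Lemma Lip_measurable {R : realType} (r : R) (f : R -> R) : Lip r f ->
  measurable_fun setT f.
Proof. by move=> /Lip_continuous; exact: continuous_measurable_fun. Qed.

(** * Stein equation *)

Section SteinEquation.
Context {R : realType}.
Implicit Types (f g h phi psi df : R -> R) (a b x y : R).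

Lemma is_derive1_ge0_le f df a b : a <= b ->
    (forall x, is_derive x 1 f (df x)) ->
    (forall x, a <= x <= b -> 0 <= df x) -> f a <= f b.
Proof.
move=> ab fdf df0.
have cf : {within `[a, b], continuous f}.
  apply/continuous_subspaceT => x.
  by apply/differentiable_continuous/derivable1_diffP; case: (fdf x).
have [c + fab] := MVT_segment ab (fun x _ => fdf x) cf.
rewrite in_itv/= => cab; rewrite -subr_ge0 fab mulr_ge0 ?subr_ge0//.
exact: df0.
Qed.

Lemma is_derive1_le_Lip f df (r : R) : (forall x, is_derive x 1 f (df x)) ->
  (forall x, `|df x| <= r) -> Lip r f.
Proof.
move=> fdf dfr.
have lip x y : x <= y -> `|f x - f y| <= r * `|x - y|.
  move=> xy; have cf : {within `[x, y], continuous f}.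
    apply/continuous_subspaceT => z.
    by apply/differentiable_continuous/derivable1_diffP; case: (fdf z).
  have [c _ fab] := MVT_segment xy (fun x _ => fdf x) cf.
  by rewrite distrC fab normrM distrC ler_wpM2r.
by move=> x y; case: (leP x y) => [|/ltW] xy; [|rewrite distrC (distrC x)];
  exact: lip.
Qed.

(** As [df] is only Lipschitz, the quadratic term minus the remainder is studied as a function [k]
    of the endpoint: its derivative has the sign of [t - a], so [k] is smallest at [a], where it
    vanishes. *)
Lemma is_derive1_Taylor_le f df a b (r : R) : (forall x, is_derive x 1 f (df x)) ->
  Lip (r *+ 2) df -> f b - f a - df a * (b - a) <= r * (b - a) ^+ 2.
Proof.
move=> fdf dfr.
pose k t := r * (t - a) ^+ 2 - (f t - f a - df a * (t - a)).
pose dk t := r *+ 2 * (t - a) - (df t - df a).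
have kdk (t : R) : is_derive t 1 k (dk t).
  rewrite /k; apply: is_derive_eq.
  by rewrite /dk /= /GRing.scale/=; ring.
have ka : k a = 0 by rewrite /k; ring.
rewrite -subr_ge0 -/(k b).
have [ab|/ltW ba] := leP a b.
  rewrite -ka; apply: (is_derive1_ge0_le ab kdk) => t /andP[at_ _].
  have := dfr t a; rewrite (ger0_norm (_ : 0 <= t - a)) ?subr_ge0//.
  by move=> /(le_trans (ler_norm _)); rewrite /dk; lra.
have kNdk (t : R) : is_derive t 1 (- k) (- dk t) by apply: is_derive_eq.
rewrite -oppr_le0 -[leRHS]oppr0 -ka.
apply: (is_derive1_ge0_le ba kNdk) => t /andP[_ ta].
have := dfr t a; rewrite (distrC t) (ger0_norm (_ : 0 <= a - t)) ?subr_ge0//.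
by rewrite distrC => /(le_trans (ler_norm _)); rewrite /dk; lra.
Qed.

Lemma is_derive1_Taylor f df a b (r : R) : (forall x, is_derive x 1 f (df x)) ->
  Lip (r *+ 2) df -> `|f b - f a - df a * (b - a)| <= r * (b - a) ^+ 2.
Proof.
move=> fdf dfr; rewrite ler_norml is_derive1_Taylor_le// andbT lerNl.
have Nfdf (x : R) : is_derive x 1 (- f) (- df x) by exact: is_deriveN (fdf x).
have NLip : Lip (r *+ 2) (fun x => - df x).
  by move=> x y; rewrite -opprD normrN; exact: dfr.
apply: le_trans (is_derive1_Taylor_le a b Nfdf NLip).
by rewrite le_eqVlt; apply/orP; left; apply/eqP; rewrite !opprfctE; ring.
Qed.

Let p := normal_pdf 0 1 : R -> R.
Let c := normal_peak 1 : R.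

Let pE x : p x = c * expR (- (x ^+ 2 / 2)).
Proof.
rewrite /p normal_pdfE ?oner_neq0// /normal_fun; congr (_ * expR _).
by rewrite subr0 expr1n mulNr.
Qed.

Let c_gt0 : 0 < c. Proof. by rewrite normal_peak_gt0. Qed.

Lemma normal_pdf01_gt0 x : 0 < p x.
Proof. by rewrite pE mulr_gt0// expR_gt0. Qed.

Lemma is_derive_normal_pdf01 x : is_derive x 1 p (- x * p x).
Proof.
rewrite (_ : p = fun x => c * expR (- (x ^+ 2 / 2))); last exact/funext/pE.
apply: is_derive_eq.
by rewrite /GRing.scale/=; field.
Qed.

Lemma cvg_normal_pdf01 : p n%:R @[n --> \oo] --> 0.
Proof.
(* From [1 + y <= expR y] at [y = n ^+ 2 / 2], and [(n + 1) / 2 <= 1 + n ^+ 2 / 2], the density at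
   [n] is at most [2 * c / (n + 1)]. *)
apply: (@squeeze_cvgr _ _ _ _ (cst 0) (fun n => 2 * c * harmonic n)).
- near=> n; rewrite /cst ltW ?normal_pdf01_gt0//= pE.
  rewrite (_ : 2 * c * _ = c * (2 * harmonic n)) ?ler_pM2l//=; last by ring.
  rewrite expRN -[2 * _]invrK lef_pV2 ?posrE ?expR_gt0 ?divr_gt0//.
  apply: le_trans (expR_ge1Dx _).
  rewrite /harmonic invfM invrK -[n.+1%:R]natr1.
  have : (0 <= n%:R :> R) by [].
  by move: (n%:R : R) => t; nra.
- exact: cvg_cst.
- rewrite -[X in _ --> X](mulr0 (2 * c)).
  by apply: cvgM; [exact: cvg_cst|exact: cvg_harmonic].
Unshelve. all: by end_near. Qed.

Lemma normal_pdf01N x : p (- x) = p x.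
Proof. by rewrite !pE sqrrN. Qed.

(** Limits along the integers are enough: they only serve to bound a value [f x] below which [f]
    does not go on one side of [x], and they come out of dominated convergence for sequences. *)
Definition vanishes f :=
  (f n%:R @[n --> \oo] --> 0) /\ (f (- n%:R) @[n --> \oo] --> 0).

Lemma vanishes_nondecreasing_le0 f x : vanishes f ->
  (forall y, x <= y -> f x <= f y) -> f x <= 0.
Proof.
move=> [f0 _] fx; rewrite -(cvg_lim _ f0)//; apply: limr_ge.
  by apply/cvg_ex; exists 0.
near=> n; apply: fx; near: n; exact: nbhs_infty_ger.
Unshelve. all: by end_near. Qed.

Lemma vanishes_nonincreasing_le0 f x : vanishes f ->
  (forall y, y <= x -> f x <= f y) -> f x <= 0.
Proof.
move=> [_ f0] fx; rewrite -(cvg_lim _ f0)//; apply: limr_ge.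
  by apply/cvg_ex; exists 0.
near=> n; apply: fx; rewrite lerNl; near: n; exact: nbhs_infty_ger.
Unshelve. all: by end_near. Qed.

Lemma vanishesD f g : vanishes f -> vanishes g -> vanishes (f \+ g).
Proof.
by move=> [f1 f2] [g1 g2]; split; rewrite -[X in _ --> X](addr0 0);
  exact: cvgD.
Qed.

Lemma vanishesN f : vanishes f -> vanishes (\- f).
Proof.
by move=> [f1 f2]; split; rewrite -[X in _ --> X]oppr0; exact: cvgN.
Qed.

Lemma vanishes_le_normal_pdf01 f (r : R) : (forall x, `|f x| <= r * p x) ->
  vanishes f.
Proof.
move=> fp; have rp0 : r * p n%:R @[n --> \oo] --> 0.
  rewrite -[X in _ --> X](mulr0 r).
  by apply: cvgM; [exact: cvg_cst|exact: cvg_normal_pdf01].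
split; apply/norm_cvg0P;
  apply: (@squeeze_cvgr _ _ _ _ (cst 0) (fun n => r * p n%:R)) => //.
- by near=> n; rewrite normr_ge0 fp.
- exact: cvg_cst.
- by near=> n; rewrite normr_ge0/= -(normal_pdf01N n%:R) fp.
- exact: cvg_cst.
Unshelve. all: by end_near. Qed.

Section nondecreasing_source.
Variables (h g : R -> R).
Hypothesis hh : {homo h : x y / x <= y}.
Hypothesis gh : forall x, is_derive x 1 g (h x * p x).
Hypothesis g0 : vanishes g.

(** Since [h] is nondecreasing, [g] first decreases and then increases between its two zero limits:
    to the right of a point where [h] is nonnegative it climbs to 0, to the left of a point where
    [h] is nonpositive it has come down from 0. *)
Lemma stein_primitive_le0 x : g x <= 0.
Proof.
have [hx|/ltW hx] := leP 0 (h x).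
  apply: vanishes_nondecreasing_le0 => // y xy.
  apply: (is_derive1_ge0_le xy gh) => z /andP[xz _].
  by rewrite mulr_ge0 ?(ltW (normal_pdf01_gt0 _))//; exact/(le_trans hx)/hh.
apply: vanishes_nonincreasing_le0 => // y yx.
have gNh (z : R) : is_derive z 1 (- g) (- (h z * p z)) by exact: is_deriveN (gh z).
rewrite -lerN2; apply: (is_derive1_ge0_le yx gNh) => z /andP[_ zx].
rewrite oppr_ge0 mulr_le0_ge0 ?(ltW (normal_pdf01_gt0 _))//.
by rewrite (le_trans (hh zx)).
Qed.

(* Mills' ratio enters through the derivative of [t / (1 + t^2) * p t], which is
   [- p t * (1 - 2 / (1 + t^2)^2)]. *)
Lemma stein_primitive_Mills x : 0 <= x ->
  (1 + x ^+ 2) * g x + x * (h x * p x) <= 0.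
Proof.
move=> x0; have [hx|/ltW hx] := leP 0 (h x); last first.
  rewrite -[leRHS]addr0 lerD//.
    by rewrite mulr_ge0_le0 ?stein_primitive_le0// addr_ge0// sqr_ge0.
  by rewrite mulr_ge0_le0// mulr_le0_ge0// ltW ?normal_pdf01_gt0.
have D0 t : 1 + t ^+ 2 != 0 :> R.
  by rewrite gt_eqF// ltr_wpDr ?sqr_ge0.
(* Freezing [h] at [x] makes [k] nondecreasing to the right of [x], because there [h t >= h x >= h x
   * (1 - 2 / (1 + t ^+ 2) ^+ 2)]. As [k] vanishes at infinity, [k x <= 0], which is the claim
   divided by [1 + x ^+ 2]. *)
pose k t := g t + h x * (t / (1 + t ^+ 2) * p t).
have kE (t : R) : is_derive t 1 k
    (h t * p t - h x * p t * (1 - 2 / (1 + t ^+ 2) ^+ 2)).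
  have := gh t; have := is_derive_normal_pdf01 t => dp dg.
  have dV : is_derive t 1 (fun t : R => (1 + t ^+ 2)^-1)
      (- (1 + t ^+ 2) ^- 2 * (2 * t)).
    have dD : is_derive t 1 (fun t : R => 1 + t ^+ 2) (2 * t).
      by apply: is_derive_eq; rewrite /GRing.scale/=; ring.
    have [d1 d2] := dD.
    split; first exact: derivableV.
    by rewrite deriveV// d2 /GRing.scale/=.
  rewrite /k; apply: is_derive_eq.
  by rewrite /GRing.scale/=; field; exact: D0.
have kx : k x <= 0.
  apply: vanishes_nondecreasing_le0.
    apply: vanishesD => //; apply: (@vanishes_le_normal_pdf01 _ (h x)) => t.
    rewrite !normrM (ger0_norm hx) ler_wpM2l// (gtr0_norm (normal_pdf01_gt0 _)).
    rewrite ler_piMl ?(ltW (normal_pdf01_gt0 _))// normfV.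
    rewrite ler_pdivrMr ?normr_gt0// mul1r [leRHS]ger0_norm ?addr_ge0 ?sqr_ge0//.
    by rewrite ler_norml; nra.
  move=> y xy; apply: (is_derive1_ge0_le xy kE) => t /andP[xt _].
  rewrite -mulrA [p t * _]mulrC mulrA -mulrBl mulr_ge0 ?(ltW (normal_pdf01_gt0 _))//.
  rewrite subr_ge0 (le_trans _ (hh xt))// ler_piMr//.
  by rewrite gerBl divr_ge0// exprn_ge0// addr_ge0// sqr_ge0.
have -> : (1 + x ^+ 2) * g x + x * (h x * p x) = (1 + x ^+ 2) * k x.
  by rewrite /k; field; exact: D0.
by rewrite mulr_ge0_le0// addr_ge0// sqr_ge0.
Qed.

End nondecreasing_source.

(* If [phi] is 1-Lipschitz then [x + (phi - m)] and [x - (phi - m)] are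
   nondecreasing, with primitives [g - p] and [- g - p]. *)
Section Lipschitz_source.
Variables (phi g : R -> R) (m : R).
Hypothesis phi1 : Lip 1 phi.
Hypothesis gE : forall x, is_derive x 1 g ((phi x - m) * p x).
Hypothesis g0 : vanishes g.

Let h1 x := (phi x - m) + x.
Let h2 x := - (phi x - m) + x.

Let h1_homo : {homo h1 : x y / x <= y}.
Proof.
move=> x y xy; have := phi1 x y; rewrite /= mul1r (distrC x).
rewrite (ger0_norm (_ : 0 <= y - x)) ?subr_ge0//.
by move=> /(le_trans (ler_norm _)); rewrite /h1; lra.
Qed.

Let h2_homo : {homo h2 : x y / x <= y}.
Proof.
move=> x y xy; have := phi1 y x; rewrite /= mul1r.
rewrite (ger0_norm (_ : 0 <= y - x)) ?subr_ge0//.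
by move=> /(le_trans (ler_norm _)); rewrite /h2; lra.
Qed.

Let vanishes_p : vanishes p.
Proof.
apply: (@vanishes_le_normal_pdf01 _ 1) => t.
by rewrite mul1r gtr0_norm// normal_pdf01_gt0.
Qed.

Let g1E (x : R) : is_derive x 1 (g \- p) (h1 x * p x).
Proof.
have := gE x; have := is_derive_normal_pdf01 x => dp dg.
by apply: is_derive_eq; rewrite /h1; ring.
Qed.

Let g2E (x : R) : is_derive x 1 (\- g \- p) (h2 x * p x).
Proof.
have := gE x; have := is_derive_normal_pdf01 x => dp dg.
by apply: is_derive_eq; rewrite /h2; ring.
Qed.

Let g1_vanishes : vanishes (g \- p).
Proof. by apply: vanishesD => //; exact: vanishesN. Qed.

Let g2_vanishes : vanishes (\- g \- p).
Proof. by apply: vanishesD => //; exact: vanishesN. Qed.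

Lemma stein_primitive_bound x : `|g x| <= p x.
Proof.
have := stein_primitive_le0 h1_homo g1E g1_vanishes x.
have := stein_primitive_le0 h2_homo g2E g2_vanishes x.
by rewrite ler_norml /=; lra.
Qed.

(** For both sources, the terms [x ^+ 2 * p x] coming from the added [x] and from the subtracted [p]
    cancel, which leaves exactly [p x]. Divided by [p x], the quantity bounded here is the
    derivative of [x * f x] for the Stein solution [f]. *)
Lemma stein_primitive_Mills_bound x : 0 <= x ->
  `|(1 + x ^+ 2) * g x + x * ((phi x - m) * p x)| <= p x.
Proof.
move=> x0.
have := stein_primitive_Mills h1_homo g1E g1_vanishes x0.
have := stein_primitive_Mills h2_homo g2E g2_vanishes x0.
by rewrite ler_norml /= /h1 /h2; nra.
Qed.

End Lipschitz_source.

(** The equation says that [f * p] has derivative [(phi - m) * p]. Taking [f = g / p] with the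
    primitive that vanishes at both ends is the only choice that keeps [f] bounded. *)
Lemma stein_solution phi g (m : R) : Lip 1 phi ->
  (forall x, is_derive x 1 g ((phi x - m) * p x)) -> vanishes g ->
  exists f psi, [/\ forall x, is_derive x 1 f (psi x),
    Lip 2 psi, forall x, `|psi x| <= 4 &
    forall x, psi x - x * f x = phi x - m].
Proof.
move=> phi1 gE g0; pose f x := g x / p x.
pose psi x := phi x - m + x * f x.
have p0 x : 0 < p x := normal_pdf01_gt0 x.
have f1 x : `|f x| <= 1.
  rewrite normrM normfV (gtr0_norm (p0 x)) ler_pdivrMr// mul1r.
  exact: stein_primitive_bound gE g0 x.
have fE x : is_derive x 1 f (psi x).
  have := gE x; have := is_derive_normal_pdf01 x => dp dg.
  have pn0 : p x != 0 by rewrite gt_eqF.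
  have dV : is_derive x 1 (fun t : R => (p t)^-1) (x / p x).
    have [d1 d2] := dp.
    split; first exact: derivableV.
    by rewrite deriveV// d2 /GRing.scale/=; field.
  rewrite /f; apply: is_derive_eq.
  by rewrite /psi /f /GRing.scale/=; field.
have vE x : is_derive x 1 (fun x => x * f x) (f x + x * psi x).
  have df := fE x; apply: is_derive_eq.
  by rewrite /GRing.scale/= [f x * 1]mulr1 addrC.
have v1 x : `|f x + x * psi x| <= 1.
  have -> : f x + x * psi x =
      ((1 + x ^+ 2) * g x + x * ((phi x - m) * p x)) / p x.
    by rewrite /psi /f; field; rewrite gt_eqF.
  rewrite normrM normfV (gtr0_norm (p0 x)) ler_pdivrMr// mul1r.
  have [x0|/ltW x0] := leP 0 x.
    exact: stein_primitive_Mills_bound gE g0 _ x0.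
  (* Negative [x] are handled by reflection: [phi (- t)] and [- g (- t)] satisfy the same
     hypotheses, [p] being even. *)
  have phiN : Lip 1 (fun t => phi (- t)).
    by move=> s t; rewrite (le_trans (phi1 _ _))// -opprD normrN.
  have gN (t : R) : is_derive t 1 (fun t => - g (- t)) ((phi (- t) - m) * p t).
    have dg := gE (- t).
    apply: is_derive_eq.
    by rewrite normal_pdf01N /GRing.scale/=; ring.
  have gN0 : vanishes (fun t => - g (- t)).
    case: g0 => g01 g02; split; rewrite -[X in _ --> X]oppr0; apply: cvgN => //.
    by under eq_fun do rewrite opprK.
  have x0' : 0 <= - x by rewrite oppr_ge0.
  have := stein_primitive_Mills_bound phiN gN gN0 x0'.
  rewrite sqrrN opprK normal_pdf01N -normrN; congr (`|_| <= _); ring.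
have psi2 : Lip 2 psi.
  move=> x y; rewrite /psi.
  have := is_derive1_le_Lip vE v1 x y; have := phi1 x y.
  move=> phixy vxy; rewrite mulrDl.
  have -> : phi x - m + x * f x - (phi y - m + y * f y) =
    (phi x - phi y) + (x * f x - y * f y) by ring.
  by rewrite (le_trans (ler_normD _ _))// lerD.
exists f, psi; split => //; last by move=> x; rewrite /psi; ring.
(* Over a step of length 1, Taylor's formula gives [|psi x| <= |f (x + 1)| + |f x| + 1 <= 3]; only
   the finiteness of the bound matters later. *)
move=> x; have := @is_derive1_Taylor f psi x (x + 1) 1 fE psi2.
rewrite (_ : x + 1 - x = 1) ?expr1n ?mulr1; last by ring.
have := f1 x; have := f1 (x + 1); rewrite !ler_norml; lra.
Qed.

Let mu := @lebesgue_measure R.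
Let nu := normal_prob 0 1 : probability (measurableTypeR R) R.

(** The density is recovered as a Radon-Nikodym derivative, which agrees with [p] almost everywhere
    because both have the same integral over every measurable set. *)
Lemma ge0_integral_normal_prob01 (k : R -> R) : measurable_fun setT k ->
  (forall x, 0 <= k x) ->
  (\int[nu]_x (k x)%:E = \int[mu]_x (k x * p x)%:E)%E.
Proof.
move=> mk k0.
have numu : nu `<< mu := @normal_prob_dominates R 0 1.
have mp : measurable_fun setT (EFin \o p).
  by apply/measurable_EFinP; exact: measurable_normal_pdf.
have mkE : measurable_fun setT (EFin \o k) by exact/measurable_EFinP.
have RN : ae_eq mu setT (Radon_Nikodym_SigmaFinite.f nu mu) (EFin \o p).
  apply: integral_ae_eq => //; first exact: Radon_Nikodym_SigmaFinite.f_integrable.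
  by move=> A _ mA; rewrite -Radon_Nikodym_SigmaFinite.f_integral.
rewrite -(Radon_Nikodym_SigmaFinite.change_of_variables numu (f := EFin \o k))//.
apply: ae_eq_integral => //.
- apply: emeasurable_funM => //; apply: (measurable_int mu).
  exact: Radon_Nikodym_SigmaFinite.f_integrable.
- by apply/measurable_EFinP; apply: measurable_funM => //; exact: measurable_normal_pdf.
- exact: ae_eqe_mul2l RN.
Qed.

Lemma integral_normal_prob01 (k : R -> R) : measurable_fun setT k ->
  mu.-integrable setT (EFin \o (fun x => k x * p x)) ->
  (\int[nu]_x (k x)%:E = \int[mu]_x (k x * p x)%:E)%E.
Proof.
move=> mk ik.
(* Writing [k] as [(k + |k|) - |k|] reduces the claim to nonnegative functions that are integrable
   against [p]. *)
have iak : mu.-integrable setT (EFin \o (fun x => `|k x| * p x)).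
  apply: eq_integrable (integrable_norm ik) => // x _ /=.
  by rewrite normrM (gtr0_norm (normal_pdf01_gt0 x)).
have mak : measurable_fun setT (fun x => `|k x|) by exact: measurableT_comp.
have mkak : measurable_fun setT (fun x => k x + `|k x|) by exact: measurable_funD.
have kak0 x : 0 <= k x + `|k x| by rewrite -lerBlDl sub0r -normrN ler_norm.
have ikak : mu.-integrable setT (EFin \o (fun x => (k x + `|k x|) * p x)).
  apply: eq_integrable (integrableD _ ik iak) => // x _ /=.
  by rewrite -EFinD -mulrDl.
have nuint (l : R -> R) : measurable_fun setT l -> (forall x, 0 <= l x) ->
    mu.-integrable setT (EFin \o (fun x => l x * p x)) ->
    nu.-integrable setT (EFin \o l).
  move=> ml l0 il; apply/integrableP; split; first exact/measurable_EFinP.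
  under eq_integral do rewrite /= ger0_norm//.
  rewrite ge0_integral_normal_prob01//; exact: integrable_lty il.
transitivity (\int[nu]_x ((k x + `|k x|) - `|k x|)%:E)%E.
  by apply: eq_integral => x _; rewrite addrK.
rewrite (integral_EFinB (nuint _ mkak kak0 ikak) (nuint _ mak _ iak))//.
rewrite !ge0_integral_normal_prob01// -integral_EFinB//.
by apply: eq_integral => x _; congr EFin => /=; ring.
Qed.

(** A wider Gaussian dominates the first moment: [|x| <= 1 + 3 / 8 * x ^+ 2 <= expR (3 / 8 * x ^+
    2)], and since [3 / 8 = 1 / 2 - 1 / 8] this factor turns [p] into a multiple of the density with
    standard deviation 2. The ratio of the normalising constants is [r]. *)
Lemma integrable_Lip1_normal_pdf01 phi : Lip 1 phi ->
  mu.-integrable setT (EFin \o (fun x => phi x * p x)).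
Proof.
move=> phi1.
have mphi := Lip_measurable phi1.
pose q := normal_pdf 0 2 : R -> R.
pose r := normal_peak 1 / normal_peak 2 : R.
have d2 : normal_peak 2 != 0 :> R by rewrite gt_eqF// normal_peak_gt0.
have xpq x : `|x| * p x <= r * q x.
  have -> : r * q x = c * expR (- x ^+ 2 / (2 ^+ 2 *+ 2)).
    by rewrite /q normal_pdfE ?pnatr_eq0// /normal_fun subr0 /r mulrA divfK.
  rewrite pE.
  rewrite mulrCA ler_pM2l//.
  rewrite [X in _ <= expR X](_ : _ = 3 / 8 * x ^+ 2 + - (x ^+ 2 / 2)); last by field.
  rewrite expRD ler_pM2r ?expR_gt0//; apply: le_trans (expR_ge1Dx _).
  have := sqr_ge0 (x - 4 / 3); have := sqr_ge0 (x + 4 / 3).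
  by rewrite ler_norml => ? ?; apply/andP; split; nra.
have ip : mu.-integrable setT (EFin \o (fun x => `|phi 0| * p x)).
  by apply: eq_integrable (integrableZl _ `|phi 0| (integrable_normal_pdf 0 1)).
have iq : mu.-integrable setT (EFin \o (fun x => r * q x)).
  by apply: eq_integrable (integrableZl _ r (integrable_normal_pdf 0 2)).
apply: integrable_le_norm (integrable_EFinD ip iq) => [|x].
  by apply: measurable_funM => //; exact: measurable_normal_pdf.
rewrite normrM (gtr0_norm (normal_pdf01_gt0 x)).
apply: (@le_trans _ _ ((`|phi 0| + `|x|) * p x)); last first.
  by rewrite mulrDl lerD2l.
rewrite ler_wpM2r ?(ltW (normal_pdf01_gt0 x))//.
rewrite -{1}[phi x](subrK (phi 0)) addrC (le_trans (ler_normD _ _))// lerD2l.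
by rewrite (le_trans (phi1 _ _))// mul1r subr0.
Qed.

Lemma Lip1_primitive phi : Lip 1 phi ->
  exists m g, [/\ (\int[nu]_x (phi x)%:E = m%:E)%E,
    forall x, is_derive x 1 g ((phi x - m) * p x) & vanishes g].
Proof.
move=> phi1; have iphi := integrable_Lip1_normal_pdf01 phi1.
have cphi := Lip_continuous phi1.
have mphi := Lip_measurable phi1.
pose m := fine (\int[nu]_x (phi x)%:E)%E.
have nuE := integral_normal_prob01 mphi iphi.
have mE : (\int[nu]_x (phi x)%:E = m%:E)%E.
  by rewrite fineK// nuE; exact: integrable_fin_num iphi.
pose k x := (phi x - m) * p x.
have ip : mu.-integrable setT (EFin \o (fun x => m * p x)).
  by apply: eq_integrable (integrableZl _ m (integrable_normal_pdf 0 1)).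
have ik : mu.-integrable setT (EFin \o k).
  apply: eq_integrable (integrableB _ iphi ip) => // x _ /=.
  by rewrite -EFinB /k mulrBl.
have k0 : (\int[mu]_x (k x)%:E = 0)%E.
  transitivity (\int[mu]_x (phi x * p x - m * p x)%:E)%E.
    by apply: eq_integral => x _; rewrite /k mulrBl.
  rewrite integral_EFinB//.
  rewrite -nuE mE.
  under [X in (_ - X)%E]eq_integral do rewrite EFinM.
  rewrite integralZl//; last exact: integrable_normal_pdf.
  by rewrite integral_normal_pdf mule1 subee.
have ck : continuous k.
  move=> x; apply: cvgM; last exact: continuous_normal_pdf.
  by apply: cvgB; [exact: cphi|exact: cvg_cst].
have mk : measurable_fun setT k by exact: continuous_measurable_fun.
(* Integrating from minus infinity makes [g] vanish there; at plus infinity it tends to the total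
   integral of [k], which is 0 by the choice of [m]. *)
pose g x := (\int[mu]_(t in `]-oo, x]) k t)%R.
exists m, g; split => //.
  move=> x; have [|||dg gE] := @continuous_FTC1 R k -oo%O x (x + 1) _ _ _ (ck x).
  - by rewrite ltrDl.
  - exact: integrableS ik.
  - by rewrite ltNyr.
  - by split; [exact: dg|rewrite -derive1E; exact: gE].
(* Dominated convergence under [|k|]: at every point the indicators of the sets [A n] are eventually
   equal to that of [B]. *)
have lim (A : nat -> set R) (B : set R) : (forall n, measurable (A n)) ->
    (forall x, \forall n \near \oo, A n x <-> B x) -> measurable B ->
    (\int[mu]_(x in A n) k x)%R @[n --> \oo] --> (\int[mu]_(x in B) k x)%R.
  move=> mA AB mB; apply: fine_cvg.
  rewrite fineK; last by apply: integrable_fin_num => //; exact: integrableS ik.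
  have := @dominated_convergence _ _ R mu setT measurableT
    (fun n => (EFin \o k) \_ (A n)) ((EFin \o k) \_ B) (abse \o (EFin \o k)).
  case.
  - move=> n; apply/(measurable_restrictT _ _).1; first exact: mA.
    by apply/measurable_EFinP; exact: measurable_funTS mk.
  - apply/(measurable_restrictT _ _).1; first exact: mB.
    by apply/measurable_EFinP; exact: measurable_funTS mk.
  - apply: aeW => x _; apply: cvg_near_cst; near=> n.
    have : A n x <-> B x by near: n; exact: AB.
    rewrite !patchE => AB'; congr (if _ then _ else _).
    by apply/idP/idP; rewrite !inE => /AB'.
  - exact: integrable_abse.
  (* Outside [A n] the restricted function takes the default value [point], which is 0. *)
  - apply: aeW => x n _; rewrite patchE; case: ifPn => // _.
    by rewrite -[point]/(0%E) abse0; exact: abse_ge0.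
  move=> _ _ /=; rewrite -integral_mkcond.
  by under eq_fun do rewrite -integral_mkcond.
split.
  have := lim (fun n => `]-oo, n%:R]%classic) setT _ _ measurableT.
  rewrite [X in _ --> X]/Rintegral k0; apply => //.
  move=> x; near=> n; split => // _ /=; rewrite in_itv/=.
  by near: n; exact: nbhs_infty_ger.
have := lim (fun n => `]-oo, - n%:R]%classic) set0 _ _ measurable0.
rewrite Rintegral_set0; apply => //.
move=> x; near=> n; split => //=; rewrite in_itv/= leNgt => /negP; apply.
by rewrite ltrNl; near: n; exact: nbhs_infty_gtr.
Unshelve. all: by end_near. Qed.

End SteinEquation.

(** * Resampling one coordinate of a product space *)

Section ProductSpace.
Context {A : countType} {d : A -> measure_display}
  {E : forall a, measurableType (d a)}.
Local Notation T := (prod_space E).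

Lemma measurable_coord a : measurable_fun setT (fun x : T => x a).
Proof.
by move=> _ B mB; rewrite setTI; apply: sub_sigma_algebra; exists a, B.
Qed.

Lemma measurable_prod_space d' (S : measurableType d') (f : S -> T) :
  (forall a, measurable_fun setT (fun s => f s a)) -> measurable_fun setT f.
Proof.
move=> mf.
apply: (@measurability d' _ S T setT f (@coord_preimages A d E)) => //.
by move=> _ [_ [a [B mB ->]] <-]; exact: mf.
Qed.

Lemma updE (x : T) a (y : E a) : upd x a y a = y.
Proof. exact: dfwithin. Qed.

Lemma upd_neq (x : T) a (y : E a) b : a != b -> upd x a y b = x b.
Proof. exact: dfwithout. Qed.

Lemma upd_upd (x : T) a (y z : E a) : upd (upd x a y) a z = upd x a z.
Proof.
apply: functional_extensionality_dep => b.
have [<-|ab] := eqVneq a b; first by rewrite !updE.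
by rewrite !upd_neq.
Qed.

Lemma measurable_upd a : measurable_fun setT (fun z : T * E a => upd z.1 a z.2).
Proof.
apply: measurable_prod_space => b; have [<-|ab] := eqVneq a b.
  rewrite (_ : (fun s => _) = snd); first exact: measurable_snd.
  by apply/funext => s; exact: updE.
under eq_fun do rewrite upd_neq//.
exact: (measurableT_comp (@measurable_coord b) measurable_fst).
Qed.

Definition box (B : forall a, set (E a)) : set T :=
  [set x | forall a, B a (x a)].

(** This pi-system generates the product sigma-field, and a product probability has an explicit
    value on it; equality of measures is checked there. *)
Definition finite_boxes : set (set T) :=
  [set C | exists B, [/\ forall a, measurable (B a),
     exists J : {fset A}, forall a, a \notin J -> B a = setT & C = box B]].

Lemma box_setT : box (fun _ => setT) = setT.
Proof. by apply/seteqP; split. Qed.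

Lemma finite_boxes_setT : finite_boxes setT.
Proof.
by exists (fun=> setT); split => //; [exists fset0|rewrite box_setT].
Qed.

Lemma finite_boxes_setI : setI_closed finite_boxes.
Proof.
move=> _ _ [B [mB [J BJ] ->]] [C [mC [K CK] ->]].
exists (fun a => B a `&` C a); split.
- by move=> a; exact: measurableI.
- exists (J `|` K)%fset => a; rewrite in_fsetU negb_or => /andP[aJ aK].
  by rewrite BJ// CK// setTI.
- by apply/seteqP; split=> [x [Bx Cx] a|x BCx]; split => // a; have [] := BCx a.
Qed.

Lemma measurable_prod_spaceE :
  @measurable _ T = <<s finite_boxes >>.
Proof.
apply/seteqP; split.
  apply: smallest_sub; first exact: smallest_sigma_algebra.
  move=> _ [a [B mB ->]]; apply: sub_sigma_algebra.
  (* The side at [b] is [B] transported along a proof of [a = b]: for [b] distinct from [a] there is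
     no such proof and the condition is vacuous, while for [b = a] uniqueness of equality proofs
     gives back [B]. *)
  exists (fun b => [set y | forall e : a = b, B (eq_rect_r E y e)]); split.
  - move=> b; have [ab|ab] := eqVneq a b.
      subst b; rewrite (_ : [set _ | _] = B)//; apply/seteqP; split => y /=.
        by move/(_ erefl).
      by move=> By e; rewrite (eq_axiomK e).
    rewrite (_ : [set _ | _] = setT)//; apply/seteqP; split => // y _ e.
    by rewrite e eqxx in ab.
  - exists [fset a]%fset => b; rewrite in_fset1 => ba.
    apply/seteqP; split => // y _ e.
    by rewrite e eqxx in ba.
  - apply/seteqP; split => x /=.
      by move=> Bx b e; subst b.
    by move=> /(_ a erefl).
apply: smallest_sub; first exact: sigma_algebra_measurable.
move=> _ [B [mB [J BJ] ->]].
rewrite (_ : box B = \bigcap_(a in [set` J]) ((fun x : T => x a) @^-1` B a)).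
  apply: fin_bigcap_measurable => // a _.
  by rewrite -[X in measurable X]setTI; exact: measurable_coord.
apply/seteqP; split => [x Bx a _|x Bx a]; first exact: Bx.
have [aJ|aJ] := boolP (a \in J); first exact: Bx.
by rewrite BJ.
Qed.

Lemma measurable_box B : finite_boxes (box B) -> measurable (box B).
Proof. by rewrite measurable_prod_spaceE => ?; exact: sub_sigma_algebra. Qed.

Section probability.
Context {R : realType} (P_ : forall a, probability (E a) R)
  (P : probability T R).
Hypothesis P_prod : is_product_prob P_ P.

Lemma prob_box (J : {fset A}) B : (forall a, measurable (B a)) ->
  (forall a, a \notin J -> B a = setT) ->
  (P (box B) = \prod_(a <- J) P_ a (B a))%E.
Proof.
move=> mB BJ; rewrite -P_prod//; congr (P _).
apply/seteqP; split => x Bx a; first by move=> _; exact: Bx.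
have [aJ|aJ] := boolP (a \in J); first exact: Bx.
by rewrite BJ.
Qed.

Lemma pushforward_coord a C : measurable C ->
  (pushforward P (fun x : T => x a) C = P_ a C)%E.
Proof.
move=> mC; rewrite /pushforward.
pose B b := dfwith (fun b => @setT (E b)) a C b.
have := @prob_box [fset a]%fset B; rewrite big_seq_fset1 /B dfwithin => <-.
- congr (P _); apply/seteqP; split => x /= Cx.
    by move=> b; case: dfwithP.
  by have := Cx a; rewrite dfwithin.
- by move=> b; case: dfwithP.
- by move=> b; rewrite in_fset1 eq_sym => ab; rewrite dfwithout.
Qed.

(** The preimage of a box is the box with its [a]-th side relaxed to [setT], times [B a], so the
    factor of [a] merely moves from [P] to [P_ a]. Every later computation with conditional means
    rests on this invariance. *)
Lemma pushforward_upd a C : measurable C ->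
  (pushforward (P \x P_ a) (fun z : T * E a => upd z.1 a z.2) C = P C)%E.
Proof.
have mupd := @measurable_upd a.
apply: (measure_unique finite_boxes (fun=> setT)) => //.
- exact: measurable_prod_spaceE.
- exact: finite_boxes_setI.
- by move=> _; exact: finite_boxes_setT.
- by rewrite bigcup_const.
- move=> _ [B [mB [J BJ] ->]].
  pose B' b := dfwith B a setT b.
  rewrite /= /pushforward.
  rewrite (_ : _ @^-1` _ = box B' `*` B a); last first.
    apply/seteqP; split => [[x y] /= Bxy|[x y] [/= B'x By]]; first split => //=.
    + move=> b; rewrite /B'; case: dfwithP => // {}b ab.
      by have := Bxy b; rewrite upd_neq.
    + by have := Bxy a; rewrite updE.
    + move=> b; have [<-|ab] := eqVneq a b; first by rewrite updE.
      by rewrite upd_neq//; have := B'x b; rewrite /B' dfwithout.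
  have mB' b : measurable (B' b) by rewrite /B'; case: dfwithP.
  have B'J b : b \notin (J `\ a)%fset -> B' b = setT.
    rewrite /B'; case: dfwithP => // {}b ab.
    by rewrite in_fsetD1 eq_sym ab => /BJ.
  rewrite product_measure1E//; last first.
    by apply: measurable_box; exists B'; split => //; exists (J `\ a)%fset.
  rewrite [X in (X * _)%E](_ : _ =
    \prod_(b <- (J `\ a)%fset) P_ b (B' b))%E; last exact: prob_box.
  (* The index set is enlarged by [a] so that its factor can be split off even when [a] is not in
     [J]. *)
  rewrite [RHS](_ : _ = \prod_(b <- (a |` J)%fset) P_ b (B b))%E; last first.
    by apply: prob_box => // b; rewrite in_fset1U negb_or => /andP[_]; exact: BJ.
  rewrite [RHS](big_fsetD1 a) ?fset1U1//= muleC; congr (_ * _)%E.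
  rewrite (_ : (a |` J) `\ a = J `\ a)%fset; last first.
    by apply/fsetP => b; rewrite !inE; case: eqP.
  rewrite [LHS]big_seq [RHS]big_seq; apply: eq_bigr => b.
  by rewrite in_fsetD1 => /andP[ba _]; rewrite /B' dfwithout// eq_sym.
- move=> _; rewrite /= /pushforward preimage_setT.
  rewrite (_ : _ setT = 1%E) ?ltry// -setXTT product_measure1E//.
  by rewrite -[RHS]mule1; congr (_ * _)%E; exact: probability_setT.
Qed.

End probability.
End ProductSpace.

(** * Square-integrable functions and variance inequalities *)

Section SquareIntegrable.
Context {d} {T : measurableType d} {R : realType}.
Implicit Types f g : T -> R.

Definition sqint (mu : {measure set T -> \bar R}) f :=
  measurable_fun setT f /\ (\int[mu]_x (f x ^+ 2)%:E < +oo)%E.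

Section measure.
Variable mu : {measure set T -> \bar R}.

Lemma sqint_integrable_sqr f : sqint mu f ->
  mu.-integrable setT (EFin \o (fun x => f x ^+ 2)).
Proof.
move=> [mf f2]; apply/integrableP; split.
  by apply/measurable_EFinP; exact: measurable_funX.
by under eq_integral do rewrite /= ger0_norm ?sqr_ge0//.
Qed.

Lemma integrable_sqr_sqint f : measurable_fun setT f ->
  mu.-integrable setT (EFin \o (fun x => f x ^+ 2)) -> sqint mu f.
Proof. by move=> mf fi; split => //; exact: integrable_lty fi. Qed.

Lemma Lfun2P f : f \in Lfun mu 2%:E <-> sqint mu f.
Proof.
split=> [f2|[mf f2]].
  apply: integrable_sqr_sqint; last exact: Lfun2_integrable_sqr.
  by move: f2; rewrite inE => /andP[]; rewrite inE.
rewrite inE; apply/andP; split; rewrite inE//=.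
rewrite /finite_norm unlock poweR_lty//.
rewrite (_ : (\int[mu]_x _)%E = \int[mu]_x (f x ^+ 2)%:E)%E//.
by apply: eq_integral => x _ /=; rewrite powR_mulrn// real_normK// num_real.
Qed.

Lemma sqint_le f g : measurable_fun setT f -> (forall x, `|f x| <= `|g x|) ->
  sqint mu g -> sqint mu f.
Proof.
move=> mf fg [mg g2]; split => //; apply: le_lt_trans g2.
apply: ge0_le_integral => //.
- by move=> x _; rewrite lee_fin sqr_ge0.
- by apply/measurable_EFinP; exact: measurable_funX.
- by apply/measurable_EFinP; exact: measurable_funX.
- by move=> x _; rewrite lee_fin -(real_normK (num_real (f x)))
    -(real_normK (num_real (g x))) lerXn2r ?nnegrE.
Qed.

Lemma sqintZ (r : R) f : sqint mu f -> sqint mu (fun x => r * f x).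
Proof.
move=> f2; have [mf _] := f2; apply: integrable_sqr_sqint.
  exact: measurable_funM.
apply: eq_integrable (integrable_EFinZ (r ^+ 2) (sqint_integrable_sqr f2)) => //.
by move=> x _ /=; rewrite exprMn.
Qed.

Lemma sqintD f g : sqint mu f -> sqint mu g -> sqint mu (fun x => f x + g x).
Proof.
move=> f2 g2; have [mf _] := f2; have [mg _] := g2.
apply: integrable_sqr_sqint; first exact: measurable_funD.
apply: integrable_le_norm (integrable_EFinZ 2
  (integrable_EFinD (sqint_integrable_sqr f2) (sqint_integrable_sqr g2))).
  by apply: measurable_funX; exact: measurable_funD.
by move=> x; rewrite ger0_norm ?sqr_ge0//; have := sqr_ge0 (f x - g x); nra.
Qed.

Lemma sqintN f : sqint mu f -> sqint mu (fun x => - f x).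
Proof.
move=> f2; have [mf _] := f2; apply: sqint_le f2 => [|x]; first exact: measurable_funN.
by rewrite normrN.
Qed.

Lemma sqintB f g : sqint mu f -> sqint mu g -> sqint mu (fun x => f x - g x).
Proof. by move=> f2 g2; apply: sqintD => //; exact: sqintN. Qed.

Lemma sqintMl (r : R) f g : sqint mu f -> measurable_fun setT g ->
  (forall x, `|g x| <= r) -> sqint mu (fun x => g x * f x).
Proof.
move=> f2 mg gr; have [mf _] := f2; apply: sqint_le (sqintZ r f2) => [|x].
  exact: measurable_funM.
by rewrite !normrM ler_wpM2r// (le_trans (gr x))// ler_norm.
Qed.

Lemma sqintM f g : sqint mu f -> sqint mu g ->
  mu.-integrable setT (EFin \o (fun x => f x * g x)).
Proof.
move=> f2 g2; have [mf _] := f2; have [mg _] := g2.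
apply: integrable_le_norm
  (integrable_EFinD (sqint_integrable_sqr f2) (sqint_integrable_sqr g2)).
  exact: measurable_funM.
move=> x; rewrite ler_norml.
have := sqr_ge0 (f x - g x); have := sqr_ge0 (f x + g x).
have := sqr_ge0 (f x); have := sqr_ge0 (g x).
by move=> *; apply/andP; split; nra.
Qed.

End measure.

Section probability.
Variable mu : probability T R.

Lemma sqint_cst (r : R) : sqint mu (fun=> r).
Proof.
split => //; rewrite integral_cst//= probability_setT mule1 ltry//.
Qed.

Lemma sqint_integrable f : sqint mu f -> mu.-integrable setT (EFin \o f).
Proof.
move=> f2; apply: eq_integrable (sqintM (sqint_cst 1) f2) => // x _ /=.
by rewrite mul1r.
Qed.

Lemma sqint_Lip f (k : R -> R) (r : R) : Lip r k -> measurable_fun setT (k \o f) ->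
  sqint mu f -> sqint mu (k \o f).
Proof.
move=> kr mk f2.
have r0 : 0 <= r.
  by have := kr 1 0; rewrite subr0 normr1 mulr1; apply: le_trans.
have mf := f2.1.
have maf : sqint mu (fun x => `|f x|).
  by apply: sqint_le f2 => [|x]; [exact: measurableT_comp|rewrite normr_id].
apply: sqint_le (sqintD (sqint_cst `|k 0|) (sqintZ r maf)) => // x.
rewrite [leRHS]ger0_norm; last by rewrite addr_ge0// mulr_ge0.
rewrite /= -[k (f x)](subrK (k 0)) addrC (le_trans (ler_normD _ _))// lerD2l.
by rewrite (le_trans (kr _ _))// subr0.
Qed.

(** Bias-variance decomposition: around the mean [m] the cross term is a constant times the integral
    of [f - m], which is 0. *)
Lemma integral_sqr_sub f (c : R) : sqint mu f ->
  (\int[mu]_x ((f x - c) ^+ 2)%:E =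
   \int[mu]_x ((f x - \int[mu]_x f x) ^+ 2)%:E
   + ((\int[mu]_x f x - c) ^+ 2)%:E)%E.
Proof.
move=> f2; set m := (\int[mu]_x f x)%R.
have fi := sqint_integrable f2.
have mE : (\int[mu]_x (f x)%:E = m%:E)%E by rewrite /m fineK// integrable_fin_num.
have fm2 : sqint mu (fun x => f x - m) by apply: sqintB => //; exact: sqint_cst.
have i1 := sqint_integrable_sqr fm2.
have i2 := integrable_EFinZ ((m - c) *+ 2) (sqint_integrable fm2).
have i3 := sqint_integrable_sqr (sqint_cst (m - c)).
rewrite (_ : (\int[mu]_x ((f x - c) ^+ 2)%:E)%E =
  (\int[mu]_x ((f x - m) ^+ 2 + (m - c) *+ 2 * (f x - m) + (m - c) ^+ 2)%:E)%E).
  rewrite integral_EFinD//; last exact: integrable_EFinD.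
  rewrite integral_EFinD// integral_cst//= probability_setT mule1.
  under [X in (_ + X + _)%E]eq_integral do rewrite EFinM.
  rewrite integralZl//; last exact: sqint_integrable.
  rewrite integral_EFinB//; last exact/sqint_integrable/sqint_cst.
  by rewrite mE integral_cst//= probability_setT mule1 subee// mule0 adde0.
by apply: eq_integral => x _; congr EFin; ring.
Qed.

Lemma integral_sqr_sub_mean_le f (c : R) : sqint mu f ->
  (\int[mu]_x ((f x - \int[mu]_x f x) ^+ 2)%:E <=
   \int[mu]_x ((f x - c) ^+ 2)%:E)%E.
Proof. by move=> f2; rewrite (integral_sqr_sub c)// leeDl// lee_fin sqr_ge0. Qed.

Lemma sqr_Rintegral_le f : sqint mu f ->
  (((\int[mu]_x f x) ^+ 2)%:E <= \int[mu]_x (f x ^+ 2)%:E)%E.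
Proof.
move=> f2; have := integral_sqr_sub 0 f2.
under eq_integral do rewrite subr0; move=> ->.
by rewrite subr0 leeDr// integral_ge0// => x _; rewrite lee_fin sqr_ge0.
Qed.

(** The mean of [k \o f] is its best constant approximation in quadratic mean, so replacing it by
    [k m] only increases the left side; the Lipschitz bound then applies pointwise. *)
Lemma variance_Lip_le f (k : R -> R) (r : R) : Lip r k ->
    measurable_fun setT (k \o f) -> sqint mu f ->
  (\int[mu]_x ((k (f x) - \int[mu]_x k (f x)) ^+ 2)%:E <=
   (r ^+ 2)%:E * \int[mu]_x ((f x - \int[mu]_x f x) ^+ 2)%:E)%E.
Proof.
move=> kr mk f2; have kf2 := sqint_Lip kr mk f2.
set m := (\int[mu]_x f x)%R.
have fm2 : sqint mu (fun x => f x - m) by apply: sqintB => //; exact: sqint_cst.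
have km2 : sqint mu (fun x => k (f x) - k m).
  by apply: sqintB => //; exact: sqint_cst.
apply: le_trans (integral_sqr_sub_mean_le (k m) kf2) _.
rewrite -integralZl//; last exact: sqint_integrable_sqr.
apply: ge0_le_integral => //.
- by move=> x _; rewrite lee_fin sqr_ge0.
- by apply/measurable_EFinP; apply: measurable_funX; exact: km2.1.
- apply/measurable_EFinP; apply: measurable_funM => //.
  by apply: measurable_funX; exact: fm2.1.
- move=> x _; rewrite -EFinM lee_fin -exprMn.
  rewrite -(real_normK (num_real (k (f x) - _))).
  rewrite -(real_normK (num_real (r * _))) lerXn2r ?nnegrE//.
  by rewrite (le_trans (kr _ _))// normrM ler_wpM2r// ler_norm.
Qed.

End probability.
End SquareIntegrable.

(** * The gradient as the fluctuation around a conditional mean *)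

Section Resampling.
Context {R : realType} {A : countType} {d : A -> measure_display}
  {E : forall a, measurableType (d a)} (P_ : forall a, probability (E a) R)
  (P : probability (prod_space E) R).
Hypothesis P_prod : is_product_prob P_ P.
Local Notation T := (prod_space E).
Implicit Types (a : A) (F G : T -> R).

Lemma ge0_integral_upd a (g : T -> \bar R) : measurable_fun setT g ->
  (forall x, 0 <= g x)%E ->
  (\int[P \x P_ a]_z g (upd z.1 a z.2) = \int[P]_x g x)%E.
Proof.
move=> mg g0; have mupd := @measurable_upd _ _ E a.
rewrite -(ge0_integral_pushforward mupd (P \x P_ a)%E measurableT mg); last by move=> x _.
by apply: eq_measure_integral => C mC _; exact: pushforward_upd.
Qed.

Lemma integrable_upd a (g : T -> \bar R) : P.-integrable setT g ->
  (P \x P_ a)%E.-integrable setT (fun z => g (upd z.1 a z.2)).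
Proof.
move=> gi; have mg := measurable_int P gi.
apply/integrableP; split; first exact: measurableT_comp (@measurable_upd _ _ E a).
rewrite (ge0_integral_upd a (g := fun x => `|g x|%E))//; last exact: measurableT_comp.
by case/integrableP : gi.
Qed.

Lemma integral_upd a (g : T -> \bar R) : P.-integrable setT g ->
  (\int[P \x P_ a]_z g (upd z.1 a z.2) = \int[P]_x g x)%E.
Proof.
move=> gi; have mg := measurable_int P gi.
rewrite [LHS]integralE [RHS]integralE; congr (_ - _)%E.
- rewrite -(ge0_integral_upd a (g := g^\+%E))//; last exact: measurable_funepos.
  by apply: eq_integral => z _; rewrite !funeposE.
- rewrite -(ge0_integral_upd a (g := g^\-%E))//; last exact: measurable_funeneg.
  by apply: eq_integral => z _; rewrite !funenegE.
Qed.

(** One independent copy of the whole family serves all indices at once; for a fixed [a] only its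
    [a]-th coordinate enters, which brings integrals over [P \x P] back to [P \x P_ a]. *)
Lemma pushforward_indep_coord a C : measurable C ->
  (pushforward (P \x P) (fun z : T * T => (z.1, z.2 a)) C = (P \x P_ a) C)%E.
Proof.
have mc : measurable_fun setT (fun z : T * T => (z.1, z.2 a)).
  apply: measurable_fun_pair => //.
  exact: (measurableT_comp (@measurable_coord _ _ E a) measurable_snd).
move=> mC; apply/esym; apply: product_measure_unique => // B D mB mD.
rewrite /= /pushforward.
rewrite (_ : _ @^-1` _ = B `*` ((fun x : T => x a) @^-1` D))//.
rewrite product_measure1E//.
- by congr (_ * _)%E; exact: (pushforward_coord P_prod).
- by rewrite -[X in measurable X]setTI; exact: measurable_coord.
Qed.

Lemma ge0_integral_indep_coord a (g : T * E a -> \bar R) :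
  measurable_fun setT g -> (forall x, 0 <= g x)%E ->
  (\int[P \x P]_z g (z.1, z.2 a) = \int[P \x P_ a]_z g z)%E.
Proof.
have mc : measurable_fun setT (fun z : T * T => (z.1, z.2 a)).
  apply: measurable_fun_pair => //.
  exact: (measurableT_comp (@measurable_coord _ _ E a) measurable_snd).
move=> mg g0.
rewrite -(ge0_integral_pushforward mc (P \x P)%E measurableT mg); last by move=> x _.
by apply: eq_measure_integral => C mC _; exact: pushforward_indep_coord.
Qed.

Lemma integral_indep_coord a (g : T * E a -> \bar R) :
  measurable_fun setT g ->
  (\int[P \x P]_z g (z.1, z.2 a) = \int[P \x P_ a]_z g z)%E.
Proof.
move=> mg; rewrite [LHS]integralE [RHS]integralE; congr (_ - _)%E.
- rewrite -(ge0_integral_indep_coord (g := g^\+%E))//; last exact: measurable_funepos.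
  by apply: eq_integral => z _; rewrite !funeposE.
- rewrite -(ge0_integral_indep_coord (g := g^\-%E))//; last exact: measurable_funeneg.
  by apply: eq_integral => z _; rewrite !funenegE.
Qed.

(** A version of the conditional expectation given all coordinates but [a]. Where the integral is
    infinite the value is 0 by convention, so linearity is only available almost everywhere. *)
Definition cmean a F (x : T) : R := (\int[P_ a]_y F (upd x a y))%R.

Lemma gradE a F x : grad P_ a F x = F x - cmean a F x.
Proof. by []. Qed.

Lemma cmean_upd a F x y : cmean a F (upd x a y) = cmean a F x.
Proof. by rewrite /cmean; apply: eq_Rintegral => z _; rewrite upd_upd. Qed.

Lemma measurable_upd_pair a F : measurable_fun setT F ->
  measurable_fun setT (fun z : T * E a => F (upd z.1 a z.2)).
Proof. by move=> mF; exact: measurableT_comp (@measurable_upd _ _ E a). Qed.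

Lemma measurable_upd_section a F x : measurable_fun setT F ->
  measurable_fun setT (fun y : E a => F (upd x a y)).
Proof.
by move=> /measurable_upd_pair mF; exact: (measurableT_comp (mF a) (measurable_pair1 x)).
Qed.

Lemma measurable_cmean a F : measurable_fun setT F ->
  measurable_fun setT (cmean a F).
Proof.
move=> mF; have mFE : measurable_fun setT (fun z : T * E a => (F (upd z.1 a z.2))%:E).
  by apply/measurable_EFinP; exact: measurable_upd_pair.
apply: (measurableT_comp (fine_measurable measurableT)).
rewrite (_ : (fun x => _) =
  (fun x => \int[P_ a]_y (fun z : T * E a => (F (upd z.1 a z.2))%:E)^\+ (x, y)) \-
  (fun x => \int[P_ a]_y (fun z : T * E a => (F (upd z.1 a z.2))%:E)^\- (x, y)))%E.
  apply: emeasurable_funB.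
  - apply: measurable_fun_fubini_tonelli_F => //; exact: measurable_funepos.
  - apply: measurable_fun_fubini_tonelli_F => //; exact: measurable_funeneg.
apply/funext => x; rewrite /= [LHS]integralE.
by congr (_ - _)%E; apply: eq_integral => y _; rewrite ?funeposE ?funenegE.
Qed.

Lemma measurable_grad a F : measurable_fun setT F ->
  measurable_fun setT (grad P_ a F).
Proof. by move=> mF; apply: measurable_funB => //; exact: measurable_cmean. Qed.

Lemma ae_sqint_section a F : sqint P F ->
  {ae P, forall x, sqint (P_ a) (fun y => F (upd x a y))}.
Proof.
move=> F2; have := ae_integrable1 (integrable_upd a (sqint_integrable_sqr F2)).
apply: filterS => x; apply: integrable_sqr_sqint.
exact: measurable_upd_section F2.1.
Qed.

Lemma integral_upd_sqr a F : measurable_fun setT F ->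
  (\int[P]_x \int[P_ a]_y (F (upd x a y) ^+ 2)%:E = \int[P]_x (F x ^+ 2)%:E)%E.
Proof.
move=> mF; have mF2 : measurable_fun setT (fun x => (F x ^+ 2)%:E).
  by apply/measurable_EFinP; exact: measurable_funX.
rewrite -(ge0_integral_upd a mF2); last by move=> x; rewrite lee_fin sqr_ge0.
rewrite fubini_tonelli1//; last by move=> x; rewrite lee_fin sqr_ge0.
by apply/measurable_EFinP; apply: measurable_funX; exact: measurable_upd_pair.
Qed.

Lemma measurable_integral_upd_sqr a (F : T * E a -> R) : measurable_fun setT F ->
  measurable_fun setT (fun x => \int[P_ a]_y (F (x, y) ^+ 2)%:E)%E.
Proof.
move=> mF; apply: (measurable_fun_fubini_tonelli_F (fun z => (F z ^+ 2)%:E)) => //.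
  by apply/measurable_EFinP; exact: measurable_funX.
by move=> z; rewrite lee_fin sqr_ge0.
Qed.

Lemma integral_cmean_sqr_le a F : sqint P F ->
  (\int[P]_x (cmean a F x ^+ 2)%:E <= \int[P]_x (F x ^+ 2)%:E)%E.
Proof.
move=> F2; rewrite -(integral_upd_sqr a F2.1).
apply: ae_ge0_le_integral; first exact: measurableT.
- by move=> x _; rewrite lee_fin sqr_ge0.
- by apply/measurable_EFinP; apply: measurable_funX; exact: measurable_cmean F2.1.
- by move=> x _; apply: integral_ge0 => y _; rewrite lee_fin sqr_ge0.
- apply: (measurable_integral_upd_sqr (F := fun z => F (upd z.1 a z.2))).
  exact: measurable_upd_pair F2.1.
- by apply: filterS (ae_sqint_section a F2) => x Fx _; exact: sqr_Rintegral_le.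
Qed.

Lemma sqint_cmean a F : sqint P F -> sqint P (cmean a F).
Proof.
move=> F2; split; first exact: measurable_cmean F2.1.
exact: le_lt_trans (integral_cmean_sqr_le a F2) F2.2.
Qed.

Lemma sqint_grad a F : sqint P F -> sqint P (grad P_ a F).
Proof. by move=> F2; apply: sqintB => //; exact: sqint_cmean. Qed.

(** Resampling the [a]-th coordinate leaves [cmean a F] unchanged, so the left side is the mean over
    [x] of the variance of [F] along that coordinate. Variance inequalities in one variable can then
    be integrated. *)
Lemma integral_grad_sqr a F : measurable_fun setT F ->
  (\int[P]_x (grad P_ a F x ^+ 2)%:E =
   \int[P]_x \int[P_ a]_y ((F (upd x a y) - cmean a F x) ^+ 2)%:E)%E.
Proof.
move=> mF; rewrite -(integral_upd_sqr a (measurable_grad a mF)).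
apply: eq_integral => x _; apply: eq_integral => y _.
by rewrite gradE cmean_upd.
Qed.

Let measurable_grad_upd a F : measurable_fun setT F ->
  measurable_fun setT (fun x => \int[P_ a]_y ((F (upd x a y) - cmean a F x) ^+ 2)%:E)%E.
Proof.
move=> mF.
apply: (measurable_integral_upd_sqr (F := fun z => F (upd z.1 a z.2) - cmean a F z.1)).
apply: measurable_funB; first exact: measurable_upd_pair.
by apply: (measurableT_comp (measurable_cmean a mF)).
Qed.

Lemma integral_grad_sqr_le a F : sqint P F ->
  (\int[P]_x (grad P_ a F x ^+ 2)%:E <= \int[P]_x (F x ^+ 2)%:E)%E.
Proof.
move=> F2; rewrite integral_grad_sqr; last exact: F2.1.
rewrite -(integral_upd_sqr a F2.1).
apply: ae_ge0_le_integral; first exact: measurableT.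
- by move=> x _; apply: integral_ge0 => y _; rewrite lee_fin sqr_ge0.
- exact: measurable_grad_upd F2.1.
- by move=> x _; apply: integral_ge0 => y _; rewrite lee_fin sqr_ge0.
- apply: (measurable_integral_upd_sqr (F := fun z => F (upd z.1 a z.2))).
  exact: measurable_upd_pair F2.1.
- apply: filterS (ae_sqint_section a F2) => x Fx _.
  have := integral_sqr_sub_mean_le 0 Fx.
  by under [X in (_ <= X)%E]eq_integral do rewrite subr0.
Qed.

Lemma integral_grad_Lip_le a F (k : R -> R) (r : R) : Lip r k ->
    measurable_fun setT (k \o F) -> sqint P F ->
  (\int[P]_x (grad P_ a (k \o F) x ^+ 2)%:E <=
   (r ^+ 2)%:E * \int[P]_x (grad P_ a F x ^+ 2)%:E)%E.
Proof.
move=> kr mk F2; rewrite integral_grad_sqr//.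
rewrite integral_grad_sqr; last exact: F2.1.
have mgu := measurable_grad_upd a F2.1.
rewrite -ge0_integralZl//; last first.
- by rewrite lee_fin sqr_ge0.
- by move=> x _; apply: integral_ge0 => y _; rewrite lee_fin sqr_ge0.
apply: ae_ge0_le_integral; first exact: measurableT.
- by move=> x _; apply: integral_ge0 => y _; rewrite lee_fin sqr_ge0.
- exact: measurable_grad_upd.
- move=> x _; rewrite mule_ge0 ?lee_fin ?sqr_ge0//.
  by apply: integral_ge0 => y _; rewrite lee_fin sqr_ge0.
- exact: measurable_funeM.
- apply: filterS (ae_sqint_section a F2) => x Fx _.
  apply: (variance_Lip_le kr) => //.
  exact: (measurable_upd_section x mk).
Qed.

Lemma ae_cmeanB a F G : sqint P F -> sqint P G ->
  {ae P, forall x, cmean a (fun x => F x - G x) x = cmean a F x - cmean a G x}.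
Proof.
move=> F2 G2; near=> x; rewrite /cmean RintegralB//; apply: sqint_integrable;
  near: x; exact: ae_sqint_section.
Unshelve. all: by end_near. Qed.

Lemma ae_gradB a F G : sqint P F -> sqint P G ->
  {ae P, forall x, grad P_ a (fun x => F x - G x) x =
    grad P_ a F x - grad P_ a G x}.
Proof.
move=> F2 G2; apply: filterS (ae_cmeanB a F2 G2) => x xE.
by rewrite !gradE xE; ring.
Qed.

Lemma ae_integral_grad0 a F : sqint P F ->
  {ae P, forall x, (\int[P_ a]_y (grad P_ a F (upd x a y))%:E = 0)%E}.
Proof.
move=> F2; apply: filterS (ae_sqint_section a F2) => x Fx.
have Fxi := sqint_integrable Fx.
under eq_integral do rewrite gradE cmean_upd.
rewrite (integral_EFinB (g := fun=> cmean a F x))//; last first.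
  exact/sqint_integrable/sqint_cst.
rewrite integral_cst//= probability_setT mule1 /cmean.
by rewrite fineK ?subee// integrable_fin_num.
Qed.

Lemma ge0_integral_fst d' (S : measurableType d') (Q : probability S R)
    (g : T -> \bar R) : measurable_fun setT g ->
  (forall x, 0 <= g x)%E ->
  (\int[P \x Q]_z g z.1 = \int[P]_x g x)%E.
Proof.
move=> mg g0; rewrite fubini_tonelli1//; last exact: (measurableT_comp mg).
apply: eq_integral => x _ /=.
by rewrite /fubini_F/= integral_cst//= probability_setT mule1.
Qed.

Lemma integral_fst d' (S : measurableType d') (Q : probability S R)
    (g : T -> \bar R) : measurable_fun setT g ->
  (\int[P \x Q]_z g z.1 = \int[P]_x g x)%E.
Proof.
move=> mg; rewrite [LHS]integralE [RHS]integralE; congr (_ - _)%E.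
- rewrite -(ge0_integral_fst Q (g := g^\+%E))//; last exact: measurable_funepos.
  by apply: eq_integral => z _; rewrite !funeposE.
- rewrite -(ge0_integral_fst Q (g := g^\-%E))//; last exact: measurable_funeneg.
  by apply: eq_integral => z _; rewrite !funenegE.
Qed.

Lemma sqint_fst a F : sqint P F -> sqint (P \x P_ a)%E (fun z => F z.1).
Proof.
move=> [mF F2]; split; first exact: (measurableT_comp mF).
rewrite (ge0_integral_fst (P_ a) (g := fun x => (F x ^+ 2)%:E))//.
  by apply/measurable_EFinP; exact: measurable_funX.
by move=> x; rewrite lee_fin sqr_ge0.
Qed.

Lemma sqint_upd a F : sqint P F ->
  sqint (P \x P_ a)%E (fun z => F (upd z.1 a z.2)).
Proof.
move=> [mF F2]; split; first exact: measurable_upd_pair.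
rewrite (ge0_integral_upd a (g := fun x => (F x ^+ 2)%:E))//.
  by apply/measurable_EFinP; exact: measurable_funX.
by move=> x; rewrite lee_fin sqr_ge0.
Qed.

Lemma integral_ae0 d' (S : measurableType d') (mu : {measure set S -> \bar R})
    (g : S -> \bar R) : measurable_fun setT g ->
  {ae mu, forall x, g x = 0%E} -> (\int[mu]_x g x = 0)%E.
Proof.
move=> mg g0; rewrite -(integral0 mu setT); apply: ae_eq_integral => //.
by apply: filterS g0 => x gx _.
Qed.

(** For fixed [y], the [a]-th coordinate of [x] is redrawn and the new draw is integrated first: [b]
    is constant in it and the gradient has mean zero there. *)
Lemma integral_grad_indep0 a (b : T * E a -> R) F : sqint P F ->
    sqint (P \x P_ a)%E b -> (forall x y y', b (upd x a y', y) = b (x, y)) ->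
  (\int[P \x P_ a]_z (b z * grad P_ a F z.1)%:E = 0)%E.
Proof.
move=> F2 b2 bupd; set K := grad P_ a F.
have K2 : sqint P K by exact: sqint_grad.
have phii := sqintM b2 (sqint_fst a K2).
set phi := (EFin \o _) in phii; rewrite -[LHS]/(\int[P \x P_ a]_z phi z)%E.
rewrite -(integral21_prod_meas1 phii).
apply: integral_ae0; first exact: measurable_fubini_G phii.
apply: filterS (ae_integrable2 phii) => y phiy.
rewrite /fubini_G -(integral_upd a phiy).
have := integrable_upd a phiy; set psi := (fun z => _) => psii.
rewrite -(integral12_prod_meas1 psii).
apply: integral_ae0; first exact: measurable_fubini_F psii.
apply: filterS2 (ae_sqint_section a K2) (ae_integral_grad0 a F2) => x Kx K0.
rewrite /fubini_F /psi /phi /=.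
under eq_integral do rewrite bupd EFinM.
by rewrite integralZl// ?K0 ?mule0//; exact: sqint_integrable Kx.
Qed.

(** The expansion point is the resampled value because the factor [psi] then does not see the
    original [a]-th coordinate; with [psi] taken at [F] the correction would not in general be
    orthogonal to the gradient of [G]. *)
Lemma stein_exchange a F G (f psi : R -> R) (r s : R) :
    sqint P F -> sqint P G -> measurable_fun setT (f \o F) -> Lip r f ->
    measurable_fun setT (psi \o F) -> (forall x, `|psi x| <= s) ->
    (forall x y, `|f x - f y - psi y * (x - y)| <= (x - y) ^+ 2) ->
  (`|\int[P]_x (grad P_ a (f \o F) x * - grad P_ a G x)%:E
    - \int[P \x P_ a]_z (psi (F (upd z.1 a z.2)) * grad P_ a F z.1
                         * - grad P_ a G z.1)%:E|
   <= \int[P]_x ((\int[P_ a]_y ((F x - F (upd x a y)) ^+ 2)%:E)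
                 * `|grad P_ a G x|%:E))%E.
Proof.
move=> F2 G2 mfF fr mpsi psis fpsi.
have mF := F2.1.
have fF2 := sqint_Lip fr mfF F2.
have K2 := sqint_grad a G2; have NK2 := sqintN K2.
set K := grad P_ a G in K2 NK2 *.
have mpsiQ : measurable_fun setT (fun z : T * E a => psi (F (upd z.1 a z.2))).
  exact: (@measurable_upd_pair a (psi \o F) mpsi).
have bpsiQ (z : T * E a) : `|psi (F (upd z.1 a z.2))| <= s by exact: psis.
(* [b] does not depend on the a-th coordinate of [z.1], so it is orthogonal to
   [K]; [rem] is the remainder of the Taylor expansion at the resampled point. *)
pose b z := f (F (upd z.1 a z.2)) - cmean a (f \o F) z.1
  + psi (F (upd z.1 a z.2)) * (cmean a F z.1 - F (upd z.1 a z.2)).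
have b2 : sqint (P \x P_ a)%E b.
  apply: sqintD.
    by apply: sqintB; [exact: sqint_upd fF2|exact/sqint_fst/sqint_cmean].
  apply: (@sqintMl _ _ _ _ s) => //.
  by apply: sqintB; [exact/sqint_fst/sqint_cmean|exact: sqint_upd].
have bupd x y y' : b (upd x a y', y) = b (x, y).
  by rewrite /b /= upd_upd !cmean_upd.
pose rem (z : T * E a) := f (F z.1) - f (F (upd z.1 a z.2))
  - psi (F (upd z.1 a z.2)) * (F z.1 - F (upd z.1 a z.2)).
have i1 := sqintM (sqint_fst a (sqint_grad a fF2)) (sqint_fst a NK2).
have i2 := sqintM (sqintMl (sqint_fst a (sqint_grad a F2)) mpsiQ bpsiQ) (sqint_fst a NK2).
have i3 := sqintM b2 (sqint_fst a K2).
(* Integrability comes from a combination of products of square-integrable functions; the Taylor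
   bound cannot provide it, since its integral may be infinite. *)
have i4 : (P \x P_ a)%E.-integrable setT (EFin \o (fun z => rem z * - K z.1)).
  apply: eq_integrable (integrable_EFinD (integrable_EFinB i1 i2) i3) => // z _ /=.
  by congr EFin; rewrite /rem /b !gradE /=; ring.
rewrite -(integral_fst (P_ a) (g := fun x => (grad P_ a (f \o F) x * - K x)%:E)); last first.
  apply/measurable_EFinP; apply: measurable_funM; last exact: NK2.1.
  exact: measurable_grad mfF.
rewrite -integral_EFinB//.
rewrite (_ : (\int[P \x P_ a]_z _)%E =
  \int[P \x P_ a]_z (rem z * - K z.1)%:E)%E; last first.
  rewrite -[LHS]adde0 -(integral_grad_indep0 G2 b2 bupd) -integral_EFinD//.
    by apply: eq_integral => z _; congr EFin; rewrite -/K /rem /b !gradE /=; ring.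
  exact: integrable_EFinB.
apply: le_trans (le_abse_integral _ measurableT (measurable_int _ i4)) _.
have mF12 : measurable_fun setT (fun z : T * E a => (F z.1 - F (upd z.1 a z.2)) ^+ 2).
  apply: measurable_funX; apply: measurable_funB; first exact: (measurableT_comp mF).
  exact: measurable_upd_pair.
have mK1 : measurable_fun setT (fun z : T * E a => `|K z.1|).
  by apply: measurableT_comp => //; exact: (measurableT_comp K2.1).
apply: (@le_trans _ _
  (\int[P \x P_ a]_z ((F z.1 - F (upd z.1 a z.2)) ^+ 2 * `|K z.1|)%:E)%E).
  apply: ge0_le_integral => //.
  - by apply: measurableT_comp => //; exact: measurable_int i4.
  - by apply/measurable_EFinP; exact: measurable_funM.
  - by move=> z _; rewrite /= lee_fin normrM normrN ler_wpM2r// /rem fpsi.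
rewrite fubini_tonelli1//; last 2 first.
- by apply/measurable_EFinP; exact: measurable_funM.
- by move=> z; rewrite lee_fin mulr_ge0// sqr_ge0.
apply: ge0_le_integral => //.
- by move=> x _; apply: integral_ge0 => y _; rewrite lee_fin mulr_ge0// sqr_ge0.
- apply: measurable_fun_fubini_tonelli_F.
    by apply/measurable_EFinP; exact: measurable_funM.
  by move=> z; rewrite lee_fin mulr_ge0// sqr_ge0.
- apply: emeasurable_funM; last first.
    by apply/measurable_EFinP; apply: measurableT_comp => //; exact: K2.1.
  apply: (measurable_integral_upd_sqr (F := fun z => F z.1 - F (upd z.1 a z.2))).
  apply: measurable_funB; first exact: (measurableT_comp mF).
  exact: measurable_upd_pair.
- move=> x _; rewrite /fubini_F /= -ge0_integralZr//.
  + by apply/measurable_EFinP; exact: (measurableT_comp mF12 (measurable_pair1 x)).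
  + by move=> y _; rewrite lee_fin sqr_ge0.
Qed.

End Resampling.

(** * The domain of the gradient *)

Section Esum.
Context {R : realType}.

Lemma esum_tail (T : choiceType) (S : T -> \bar R) (e : R) : 0 < e ->
    (forall a, 0 <= S a)%E -> (\esum_(a in [set: T]) S a < +oo)%E ->
  exists K : {fset T}, (\esum_(a in ~` [set` K]) S a < e%:E)%E.
Proof.
move=> e0 S0 Soo.
have Sfin : (\esum_(a in [set: T]) S a)%E \is a fin_num.
  by rewrite ge0_fin_numE// esum_ge0.
have [_ [K [finK _]] <-] := ub_ereal_sup_adherent e0 Sfin.
rewrite -/(esum _ _) -esum_fset// => SK; exists (fset_set K).
rewrite fset_setK//; move: SK.
rewrite (esumID K) ?setTI//.
have fK : (\esum_(a in K) S a)%E \is a fin_num.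
  rewrite ge0_fin_numE ?esum_ge0//; apply: le_lt_trans Soo.
  by rewrite (esumID K setT)// setTI leeDl// esum_ge0.
by rewrite lteBlDr// lteD2lE.
Qed.

Lemma esum_fset_cst (T : choiceType) (K : {fset T}) : exists2 N : R, 0 <= N &
  forall c : R, 0 <= c -> (\esum_(a in [set` K]) c%:E = (N * c)%:E)%E.
Proof.
exists (\sum_(a <- K) 1) => [|c c0]; first exact: sumr_ge0.
rewrite esum_fset// fsbig_finite//= set_fsetK sumEFin mulr_suml.
by congr EFin; apply: eq_bigr => a _; rewrite mul1r.
Qed.

Lemma esumZ (T : choiceType) (I : set T) (r : R) (S : T -> \bar R) : 0 <= r ->
  (forall a, 0 <= S a)%E ->
  (\esum_(a in I) (r%:E * S a) = r%:E * \esum_(a in I) S a)%E.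
Proof.
have le (q : R) (U : T -> \bar R) : 0 <= q -> (forall a, 0 <= U a)%E ->
    (\esum_(a in I) (q%:E * U a) <= q%:E * \esum_(a in I) U a)%E.
  move=> q0 U0; apply: ge_ereal_sup => _ [K [finK KI] <-].
  rewrite -ge0_mule_fsumr//; apply: lee_wpmul2l; first by rewrite lee_fin.
  by apply: ereal_sup_ubound; exists K.
rewrite le_eqVlt => /predU1P[<-|r0] S0.
  by rewrite mul0e esum1// => a _; rewrite mul0e.
apply/eqP; rewrite eq_le le ?(ltW r0)//=.
rewrite -lee_pdivlMl//.
(* The reverse inequality is the same one for [r^-1] and the family [r * S]. *)
have := le r^-1 (fun a => r%:E * S a)%E.
rewrite invr_ge0 (ltW r0) => /(_ isT) H.
apply: le_trans (H _); last by move=> a; rewrite mule_ge0// lee_fin ltW.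
by apply: le_esum => a _; rewrite muleA -EFinM mulVf ?gt_eqF// mul1e.
Qed.

End Esum.

Section Domain.
Context {R : realType} {A : countType} {d : A -> measure_display}
  {E : forall a, measurableType (d a)} (P_ : forall a, probability (E a) R)
  (P : probability (prod_space E) R).
Hypothesis P_prod : is_product_prob P_ P.
Local Notation T := (prod_space E).
Implicit Types (F G H : T -> R).

Definition energy a F : \bar R := (\int[P]_x (grad P_ a F x ^+ 2)%:E)%E.

Lemma energy_ge0 a F : (0 <= energy a F)%E.
Proof. by apply: integral_ge0 => x _; rewrite lee_fin sqr_ge0. Qed.

Lemma Dnorm_ltP F (e : R) : 0 < e -> (Dnorm P_ P F < e%:E)%E <->
  (\int[P]_x (F x ^+ 2)%:E + \esum_(a in [set: A]) energy a F < (e ^+ 2)%:E)%E.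
Proof.
move=> e0; rewrite /Dnorm.
rewrite [X in sqrte X](_ : _ =
    \int[P]_x (F x ^+ 2)%:E + \esum_(a in [set: A]) energy a F)%E; last first.
  congr (_ + _)%E; first by rewrite unlock.
  apply: eq_esum => a _; rewrite unlock; apply: eq_integral => x _.
  by rewrite real_normK// num_real.
have -> : e%:E = sqrte (e ^+ 2)%:E by rewrite /= sqrtr_sqr gtr0_norm.
rewrite !ltNge lee_sqrt//.
apply: adde_ge0; last by apply: esum_ge0 => a _; exact: energy_ge0.
by apply: integral_ge0 => x _; rewrite lee_fin sqr_ge0.
Qed.

Lemma energy_cylindrical0 (J : {fset A}) G a : a \notin J ->
  (forall x y : T, (forall b, b \in J -> x b = y b) -> G x = G y) ->
  energy a G = 0%E.
Proof.
move=> aJ GJ; rewrite /energy.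
rewrite -[RHS](integral0 P setT); apply: eq_integral => x _.
rewrite /grad (_ : (\int[P_ a]_y G (upd x a y))%R = G x) ?subrr ?expr0n//.
transitivity (\int[P_ a]_y (cst (G x) y)); last first.
  by rewrite /Rintegral/= integral_cst//= probability_setT mule1.
apply: eq_Rintegral => y _; apply: GJ => b bJ; rewrite upd_neq//.
by apply: contraNneq aJ => ->.
Qed.

Lemma energy_le_sqr a F : sqint P F -> (energy a F <= \int[P]_x (F x ^+ 2)%:E)%E.
Proof. exact: integral_grad_sqr_le. Qed.

Lemma energy_fin a F : sqint P F -> energy a F \is a fin_num.
Proof.
move=> F2; rewrite ge0_fin_numE ?energy_ge0//.
by apply: le_lt_trans (energy_le_sqr a F2) _; case: F2.
Qed.

(** From [(u + v) ^+ 2 <= 2 * (u ^+ 2 + v ^+ 2)]. The hypothesis is almost sure because gradients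
    are additive only almost surely, and the factor 2 is harmless since only smallness or finiteness
    of energies is sought. *)
Lemma energy_ae_le a F G H : sqint P F -> sqint P G -> sqint P H ->
    {ae P, forall x, `|grad P_ a F x| <= `|grad P_ a G x| + `|grad P_ a H x|} ->
  (energy a F <= 2%:E * (energy a G + energy a H))%E.
Proof.
move=> F2 G2 H2 FGH.
have m2 K : sqint P K -> measurable_fun setT (fun x => (grad P_ a K x ^+ 2)%:E).
  move=> [mK _]; apply/measurable_EFinP; apply: measurable_funX.
  exact: measurable_grad.
have g0 K x : (0 <= (grad P_ a K x ^+ 2)%:E)%E by rewrite lee_fin sqr_ge0.
rewrite /energy -ge0_integralD//; do ?exact: m2.
rewrite -ge0_integralZl//; last 2 first.
- by apply: emeasurable_funD; exact: m2.
- by move=> x _; rewrite adde_ge0.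
apply: ae_ge0_le_integral; first exact: measurableT.
- by move=> x _.
- exact: m2.
- by move=> x _; rewrite mule_ge0// adde_ge0.
- by apply: measurable_funeM; apply: emeasurable_funD; exact: m2.
- apply: filterS FGH => x xFGH _; rewrite -EFinD -EFinM lee_fin.
  rewrite -(real_normK (num_real (grad P_ a F x))).
  rewrite -(real_normK (num_real (grad P_ a G x))).
  rewrite -(real_normK (num_real (grad P_ a H x))).
  have := normr_ge0 (grad P_ a F x); have := sqr_ge0 (`|grad P_ a G x| - `|grad P_ a H x|).
  by move: xFGH; move: `|grad P_ a F x| `|grad P_ a G x| `|grad P_ a H x| => u v w; nra.
Qed.

Lemma energyB_le a F G : sqint P F -> sqint P G ->
  (energy a (fun x => F x - G x)%R <= 2%:E * (energy a F + energy a G))%E.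
Proof.
move=> F2 G2; apply: energy_ae_le => //; first exact: sqintB.
apply: filterS (ae_gradB P_prod a F2 G2) => x ->.
by rewrite (le_trans (ler_normB _ _)).
Qed.

Lemma energy_triangle_l a F G : sqint P F -> sqint P G ->
  (energy a F <= 2%:E * (energy a (fun x => F x - G x)%R + energy a G))%E.
Proof.
move=> F2 G2; apply: energy_ae_le => //; first exact: sqintB.
apply: filterS (ae_gradB P_prod a F2 G2) => x ->.
by rewrite -{1}[grad P_ a F x](subrK (grad P_ a G x)) ler_normD.
Qed.

Lemma energy_triangle_r a F G : sqint P F -> sqint P G ->
  (energy a G <= 2%:E * (energy a (fun x => F x - G x)%R + energy a F))%E.
Proof.
move=> F2 G2; apply: energy_ae_le => //; first exact: sqintB.
apply: filterS (ae_gradB P_prod a F2 G2) => x ->.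
by rewrite -{1}[grad P_ a G x](subrK (grad P_ a F x)) (le_trans (ler_normD _ _))//
  distrC.
Qed.

Lemma energy_Lip_le a F (f : R -> R) (r : R) : Lip r f -> sqint P F ->
  (energy a (f \o F) <= (r ^+ 2)%:E * energy a F)%E.
Proof.
move=> fr F2; apply: integral_grad_Lip_le => //.
by apply: measurableT_comp F2.1; exact: Lip_measurable fr.
Qed.

(** One cylindrical function within distance 1 suffices: its energies are finite and vanish off a
    finite set, and those of the difference have a finite sum. *)
Lemma domD_energy F : domD P_ P F -> (\esum_(a in [set: A]) energy a F < +oo)%E.
Proof.
move=> [/Lfun2P F2 /(_ 1 ltr01)[G [/Lfun2P G2 [J GJ]]]].
move=> /Dnorm_ltP => /(_ ltr01) FG.
apply: (@le_lt_trans _ _ (\esum_(a in [set: A])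
  2%:E * (energy a (fun x => F x - G x)%R + energy a G))%E).
  by apply: le_esum => a _; exact: energy_triangle_l.
rewrite esumZ//; last by move=> a; rewrite adde_ge0// energy_ge0.
rewrite esumD; do ?by move=> a _; exact: energy_ge0.
rewrite lte_mul_pinfty// lte_add_pinfty//.
  apply: (@le_lt_trans _ _ (1 ^+ 2)%:E); last exact: ltry.
  apply/ltW/(le_lt_trans _ FG); rewrite leeDr// integral_ge0// => x _.
  by rewrite lee_fin sqr_ge0.
rewrite (esumID [set` J] setT); last by move=> a _; exact: energy_ge0.
rewrite !setTI [X in (_ + X)%E]esum1 ?adde0; last first.
  by move=> a aJ; apply: energy_cylindrical0 GJ; exact/negP.
rewrite esum_fset//; last by move=> a _; exact: energy_ge0.
rewrite fsbig_finite//= lte_sum_pinfty// => a _.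
by rewrite -ge0_fin_numE ?energy_ge0//; exact: energy_fin.
Qed.

(* For an approximation [G] of [F], the energies of [f(F) - f(G)] are small on a
   finite set [K] because they are bounded by the L^2 norm, and summably small
   outside [K] because they are dominated by the energies of [F] and [F - G]. *)
Lemma domD_Lip F (f : R -> R) (r : R) : Lip r f -> domD P_ P F ->
  domD P_ P (f \o F).
Proof.
move=> fr FD; have SF := domD_energy FD; case: FD => /Lfun2P F2 FD.
have mf := Lip_measurable fr.
have fsq K : sqint P K -> sqint P (f \o K).
  by move=> K2; apply: (sqint_Lip fr) => //; exact: measurableT_comp K2.1.
split; first exact/Lfun2P/fsq.
move=> e e0; have [C CE] : exists C, C = r ^+ 2 by eexists.
have C0 : 0 <= C by rewrite CE sqr_ge0.
(* The choices are made in the order [eta], [K], [N], [z], since [K] depends on [eta] and [z] on the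
   size [N] of [K]. They bring the final total [C * ((5 + N) * z) + C * 6 * eta] to
   [C / (C + 1) * e ^+ 2], below [e ^+ 2] even when [C] is 0. In [5 + N], the norm accounts for 1,
   the tail for 4 and [K] for [N]. *)
have [eta etaE] : exists eta, eta = e ^+ 2 / (12 * (C + 1)) by eexists.
have C1 : 0 < C + 1 by rewrite ltr_wpDl.
have eta0 : 0 < eta by rewrite etaE divr_gt0 ?exprn_gt0// mulr_gt0.
have [K SK] := esum_tail eta0 (fun a => energy_ge0 a F) SF.
have [N N0 NE] := esum_fset_cst (R := R) K.
have [z zE] : exists z, z = e ^+ 2 / (2 * (C + 1) * (5 + N)) by eexists.
pose zeta := Num.sqrt z.
have N5 : 0 < 5 + N by rewrite ltr_pwDl.
have z0 : 0 < z.
  by rewrite zE divr_gt0 ?exprn_gt0// !mulr_gt0.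
have zeta0 : 0 < zeta by rewrite sqrtr_gt0.
have [G [/Lfun2P G2 [J GJ]] /(Dnorm_ltP _ zeta0)] := FD _ zeta0.
rewrite sqr_sqrtr ?(ltW z0)// => FG.
have FG2 : sqint P (fun x => F x - G x) by exact: sqintB.
exists (f \o G).
  split; first exact/Lfun2P/fsq.
  by exists J => x y xy /=; rewrite (GJ x y).
apply/Dnorm_ltP => //.
have fFG2 : sqint P (fun x => f (F x) - f (G x)) by apply: sqintB; exact: fsq.
have nFG0 : (0 <= \int[P]_x ((F x - G x) ^+ 2)%:E)%E.
  by apply: integral_ge0 => x _; rewrite lee_fin sqr_ge0.
have SFG0 : (0 <= \esum_(a in [set: A]) energy a (fun x => F x - G x)%R)%E.
  by apply: esum_ge0 => a _; exact: energy_ge0.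
have nz : (\int[P]_x ((F x - G x) ^+ 2)%:E <= z%:E)%E.
  by apply/ltW/(le_lt_trans _ FG); rewrite leeDl.
have Sz : (\esum_(a in [set: A]) energy a (fun x => F x - G x)%R <= z%:E)%E.
  by apply/ltW/(le_lt_trans _ FG); rewrite leeDr.
have nH : (\int[P]_x (((f \o F) x - (f \o G) x) ^+ 2)%:E <= (C * z)%:E)%E.
  apply: (@le_trans _ _ (C%:E * \int[P]_x ((F x - G x) ^+ 2)%:E)%E); last first.
    by rewrite (EFinM C z) lee_wpmul2l// lee_fin.
  rewrite -ge0_integralZl//; last 2 first.
  - by apply/measurable_EFinP; apply: measurable_funX; exact: FG2.1.
  - by move=> x _; rewrite lee_fin sqr_ge0.
  apply: ge0_le_integral => //.
  - by move=> x _; rewrite lee_fin sqr_ge0.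
  - by apply/measurable_EFinP; apply: measurable_funX; exact: fFG2.1.
  - apply: measurable_funeM.
    by apply/measurable_EFinP; apply: measurable_funX; exact: FG2.1.
  - move=> x _; rewrite -EFinM lee_fin CE -exprMn.
    rewrite -(real_normK (num_real (_ - _))) -(real_normK (num_real (r * _))).
    rewrite lerXn2r ?nnegrE// normrM (le_trans (fr _ _))//.
    by rewrite ler_wpM2r// ler_norm.
(* The constants combine a bound of this energy by [2 * C] times the energies of [F] and [G] with a
   bound of the energy of [G] by twice those of [F - G] and [F]. *)
have eH a : (energy a (fun x => (f \o F) x - (f \o G) x)%R <=
    (C * 6)%:E * energy a F + (C * 4)%:E * energy a (fun x => F x - G x)%R)%E.
  apply: le_trans (energyB_le a (fsq _ F2) (fsq _ G2)) _.
  have := energy_Lip_le a fr F2; have := energy_Lip_le a fr G2.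
  have := energy_triangle_r a F2 G2.
  have := energy_ge0 a F; have := energy_ge0 a G.
  have := energy_fin a (fsq _ F2); have := energy_fin a (fsq _ G2).
  have := energy_fin a F2; have := energy_fin a G2; have := energy_fin a FG2.
  case: (energy a (f \o F)) => // u1 + + + + /[dup] _.
  case: (energy a (f \o G)) => // u2.
  case: (energy a F) => // u3; case: (energy a G) => // u4.
  case: (energy a (fun x => F x - G x)) => // u5 _ _ _ _ _.
  rewrite -!EFinD -?EFinM -?EFinD -?EFinM !lee_fin -CE => *.
  by nra.
rewrite (esumID [set` K] setT); last by move=> a _; exact: energy_ge0.
rewrite !setTI.
have b1 : (\esum_(a in [set` K]) energy a (fun x => (f \o F) x - (f \o G) x)%R
    <= (N * (C * z))%:E)%E.
  rewrite -NE; last by rewrite mulr_ge0// ltW.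
  by apply: le_esum => a _; apply: le_trans nH; exact: energy_le_sqr.
have b2 : (\esum_(a in ~` [set` K]) energy a (fun x => (f \o F) x - (f \o G) x)%R
    <= (C * 6 * eta + C * 4 * z)%:E)%E.
  apply: (@le_trans _ _ (\esum_(a in ~` [set` K]) ((C * 6)%:E * energy a F
     + (C * 4)%:E * energy a (fun x => F x - G x)%R))%E).
    by apply: le_esum => a _.
  rewrite esumD; last 2 first.
  - by move=> a _; rewrite mule_ge0 ?energy_ge0// lee_fin mulr_ge0.
  - by move=> a _; rewrite mule_ge0 ?energy_ge0// lee_fin mulr_ge0.
  rewrite !esumZ ?mulr_ge0//; do ?by move=> a; exact: energy_ge0.
  rewrite EFinD !(EFinM (C * _)) leeD// lee_wpmul2l ?lee_fin ?mulr_ge0//.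
    exact: ltW.
  apply: le_trans Sz; rewrite [leRHS](esumID (~` [set` K]) setT) ?setTI.
    by rewrite leeDl// esum_ge0// => a _; exact: energy_ge0.
  by move=> a _; exact: energy_ge0.
apply: le_lt_trans (leeD nH (leeD b1 b2)) _; rewrite -!EFinD lte_fin.
rewrite (_ : C * z + _ = C * ((5 + N) * z) + C * 6 * eta); last by ring.
have -> : (5 + N) * z = e ^+ 2 / (2 * (C + 1)).
  by rewrite zE; field; rewrite !gt_eqF.
have -> : C * 6 * eta = C * (e ^+ 2 / (2 * (C + 1))).
  by rewrite etaE; field; rewrite !gt_eqF.
rewrite (_ : _ + _ = C / (C + 1) * e ^+ 2); last by field; rewrite gt_eqF.
by rewrite gtr_pMl ?exprn_gt0// ltr_pdivrMr// mul1r ltrDl.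
Qed.

End Domain.

(** * The bound *)

Section UnorderedSum.
Context {R : realType} {A : countType}.

(** [A] is enumerated through its codes, a number that codes no element contributing 0. Unordered
    sums of nonnegative functions thus become series, to which monotone convergence applies. *)
Lemma esum_countE (f : A -> \bar R) : (forall a, 0 <= f a)%E ->
  (\esum_(a in [set: A]) f a = \sum_(n <oo) oapp f 0 (pickle_inv n))%E.
Proof.
move=> f0; have g0 n : (0 <= oapp f 0 (pickle_inv n : option A))%E.
  by case: (pickle_inv n) => /=.
rewrite nneseries_esumT//.
rewrite [RHS](esumID (range (@choice.pickle A)))// !setTI.
rewrite [X in (_ = _ + X)%E]esum1 ?adde0; last first.
  move=> n nA; have := @pickle_invK A n; case: (pickle_inv n) => //= a an.
  by exfalso; apply: nA; exists a.
rewrite esum_image; last by move=> a b _ _; exact: (pcan_inj choice.pickleK).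
by apply: eq_esum => a _; rewrite pickleK_inv.
Qed.

Section integral.
Context {d} {T : measurableType d}.

Lemma measurable_esum (f : A -> T -> \bar R) :
  (forall a, measurable_fun setT (f a)) -> (forall a x, 0 <= f a x)%E ->
  measurable_fun setT (fun x => \esum_(a in [set: A]) f a x)%E.
Proof.
move=> mf f0.
rewrite (_ : (fun x => _) =
    (fun x => \sum_(n <oo) oapp (f^~ x) 0 (pickle_inv n)))%E; last first.
  by apply/funext => x; rewrite esum_countE.
apply: (ge0_emeasurable_sum (P := xpredT)
  (h := fun n x => oapp (f^~ x) 0%E (pickle_inv n))).
- by move=> n x _ _; case: (pickle_inv n) => /=.
- by move=> n _; case: (pickle_inv n) => /=.
Qed.

Lemma integral_esum (mu : {measure set T -> \bar R}) (f : A -> T -> \bar R) :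
  (forall a, measurable_fun setT (f a)) -> (forall a x, 0 <= f a x)%E ->
  (\int[mu]_x (\esum_(a in [set: A]) f a x) =
   \esum_(a in [set: A]) \int[mu]_x f a x)%E.
Proof.
move=> mf f0; rewrite esum_countE; last by move=> a; exact: integral_ge0.
under eq_integral do rewrite esum_countE//.
rewrite integral_nneseries//.
- apply: eq_eseriesr => n _; case: (pickle_inv n) => //=.
  by rewrite integral0.
- by move=> n; case: (pickle_inv n) => /=.
- by move=> n x _; case: (pickle_inv n) => /=.
Qed.

End integral.

Lemma funepos_le_abse T (f : T -> \bar R) x : (f^\+ x <= `|f x|)%E.
Proof. by rewrite -[leRHS]/((abse \o f) x) fune_abse leeDl. Qed.

Lemma funeneg_le_abse T (f : T -> \bar R) x : (f^\- x <= `|f x|)%E.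
Proof. by rewrite -[leRHS]/((abse \o f) x) fune_abse leeDr. Qed.

Lemma summable_usum_parts (f : A -> \bar R) : summable [set: A] f ->
  (\esum_(a in [set: A]) f^\+ a)%E \is a fin_num /\
  (\esum_(a in [set: A]) f^\- a)%E \is a fin_num.
Proof.
move=> fs; split; rewrite ge0_fin_numE ?esum_ge0//.
- by apply: le_lt_trans fs; apply: le_esum => a _; exact: funepos_le_abse.
- by apply: le_lt_trans fs; apply: le_esum => a _; exact: funeneg_le_abse.
Qed.

Lemma usum_fin_num (f : A -> \bar R) : summable [set: A] f ->
  usum f \is a fin_num.
Proof. by move=> /summable_usum_parts[? ?]; rewrite /usum fin_numB; apply/andP. Qed.

Lemma usumN (f : A -> \bar R) : summable [set: A] f ->
  usum (fun a => - f a)%E = (- usum f)%E.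
Proof.
move=> /summable_usum_parts[fp fn].
rewrite /usum -[X in esum _ X^\+%E]/(\- f)%E -[X in esum _ X^\-%E]/(\- f)%E.
by rewrite funeposN funenegN fin_num_oppeB// addeC.
Qed.

(** Moving the negative parts across leaves an inequality between sums of nonnegative terms, so the
    sum of [r] may be infinite. *)
Lemma le_usum (f g r : A -> \bar R) : summable [set: A] f ->
    summable [set: A] g -> (forall a, 0 <= r a)%E ->
    (forall a, f a <= g a + r a)%E ->
  (usum f <= usum g + \esum_(a in [set: A]) r a)%E.
Proof.
move=> fs gs r0 fgr.
have [fp fn] := summable_usum_parts fs; have [gp gn] := summable_usum_parts gs.
rewrite /usum leeBlDr// addeAC -addeA addeAC leeBrDr//.
rewrite -!esumD//; do ?by move=> a _; rewrite adde_ge0.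
apply: le_esum => a _.
have := summable_pinfty fs (x := a) I; have := summable_pinfty gs (x := a) I.
move: (fgr a) (r0 a); rewrite !funeposE !funenegE.
case: (f a) => [u| |] //; case: (g a) => [v| |] //; case: (r a) => [w| |] //.
- rewrite -?EFinN -?EFin_max -?EFinD !lee_fin => uvw w0 _ _.
  by rewrite /Num.max; do !case: ifPn => //; lra.
- move=> _ _ _ _; rewrite -?EFinN -?EFin_max -?EFinD addeC addye ?leey//.
Qed.

Section integral_usum.
Context {d} {T : measurableType d}.
Variables (mu : {measure set T -> \bar R}) (f : A -> T -> R).
Hypothesis mf : forall a, measurable_fun setT (f a).
Hypothesis fs : (\esum_(a in [set: A]) \int[mu]_x `|f a x|%:E < +oo)%E.

Let X x := (\esum_(a in [set: A]) (EFin \o f a)^\+ x)%E.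
Let Y x := (\esum_(a in [set: A]) (EFin \o f a)^\- x)%E.

Let mEf a : measurable_fun setT (EFin \o f a).
Proof. exact/measurable_EFinP. Qed.

Let integrable_part (g : A -> T -> \bar R) :
  (forall a, measurable_fun setT (g a)) -> (forall a x, 0 <= g a x)%E ->
  (forall a x, g a x <= `|f a x|%:E)%E ->
  summable [set: A] (fun a => \int[mu]_x g a x)%E /\
  mu.-integrable setT (fun x => \esum_(a in [set: A]) g a x)%E.
Proof.
move=> mg g0 gf.
have gs : (\esum_(a in [set: A]) \int[mu]_x g a x < +oo)%E.
  apply: le_lt_trans fs; apply: le_esum => a _; apply: ge0_le_integral => //.
  by apply/measurable_EFinP; exact: measurableT_comp.
split.
  rewrite /summable; under eq_esum do rewrite gee0_abs ?integral_ge0//.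
  exact: gs.
apply/integrableP; split; first exact: measurable_esum.
under eq_integral do rewrite gee0_abs ?esum_ge0//.
by rewrite integral_esum.
Qed.

Let Xi := integrable_part (fun a => measurable_funepos (mEf a))
  (fun a x => funepos_ge0 _ x) (fun a x => funepos_le_abse _ x).

Let Yi := integrable_part (fun a => measurable_funeneg (mEf a))
  (fun a x => funeneg_ge0 _ x) (fun a x => funeneg_le_abse _ x).

Let usumE x : usum (fun a => (f a x)%:E) = (X x - Y x)%E.
Proof.
by rewrite /usum /X /Y; congr (_ - _)%E; apply: eq_esum => a _;
  rewrite ?funeposE ?funenegE.
Qed.

Lemma integrable_usum :
  mu.-integrable setT (fun x => usum (fun a => (f a x)%:E)).
Proof.
rewrite (_ : (fun x => _) = X \- Y)%E; last exact/funext/usumE.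
by apply: integrableB => //; [exact: Xi.2|exact: Yi.2].
Qed.

Lemma integral_usum : (\int[mu]_x usum (fun a => (f a x)%:E) =
  usum (fun a => \int[mu]_x (f a x)%:E))%E.
Proof.
under eq_integral do rewrite usumE.
rewrite (integralB measurableT Xi.2 Yi.2) !integral_esum//; last first.
- by move=> a; exact: measurable_funepos.
- by move=> a; exact: measurable_funeneg.
rewrite -esumB; [|exact: Xi.1|exact: Yi.1| |].
- rewrite /usum; congr (_ - _)%E; apply: eq_esum => a _;
    by rewrite ?funeposE ?funenegE [in RHS]integralE.
- by move=> a _; apply: integral_ge0.
- by move=> a _; apply: integral_ge0.
Qed.

Lemma summable_integral_usum :
  summable [set: A] (fun a => \int[mu]_x (f a x)%:E)%E.
Proof.
rewrite /summable; apply: le_lt_trans fs; apply: le_esum => a _.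
exact: le_trans (le_abse_integral mu measurableT (mEf a)) _.
Qed.

End integral_usum.
End UnorderedSum.

(** * Stein's method for a functional in the domain of the gradient *)

Section Bound.
Context {R : realType} {A : countType} {d : A -> measure_display}
  {E : forall a, measurableType (d a)} (P_ : forall a, probability (E a) R)
  (P : probability (prod_space E) R).
Hypothesis P_prod : is_product_prob P_ P.
Variable F : {RV P >-> measurableTypeR R}.
Hypothesis F_domD : domD P_ P F.
Variable LinvF : prod_space E -> R.
Hypothesis LinvF_def : is_Linv P_ P F LinvF.

Let exchange_term (psi : R -> R) a (z : prod_space E * prod_space E) : R :=
  psi (F (upd z.1 a (z.2 a))) * grad P_ a F z.1 * - grad P_ a LinvF z.1.

Let remainder a : \bar R :=
  (\int[P]_x ((\int[P_ a]_y ((F x - F (upd x a y)) ^+ 2)%:E)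
              * `|grad P_ a LinvF x|%:E))%E.

Let F2 : sqint P F. Proof. by apply/Lfun2P; case: F_domD. Qed.

Let G2 : sqint P LinvF. Proof. by case: LinvF_def => -[/Lfun2P]. Qed.

Let remainder_ge0 a : (0 <= remainder a)%E.
Proof.
apply: integral_ge0 => x _; rewrite mule_ge0 ?lee_fin//.
by apply: integral_ge0 => y _; rewrite lee_fin sqr_ge0.
Qed.

Lemma energy_Linv_lty : (\esum_(a in [set: A]) energy P_ P a LinvF < +oo)%E.
Proof.
case: LinvF_def => _ _ [[_ +] _ _]; apply: le_lt_trans.
by apply: le_esum => a _; rewrite unlock.
Qed.

Let integral_mul_grad_le a H K : sqint P H -> sqint P K ->
  (\int[P]_x `|grad P_ a H x * grad P_ a K x|%:E <=
   energy P_ P a H + energy P_ P a K)%E.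
Proof.
move=> H2 K2; have H2' := sqint_grad P_prod a H2; have K2' := sqint_grad P_prod a K2.
rewrite /energy -integral_EFinD; do ?exact: sqint_integrable_sqr.
apply: ge0_le_integral => //.
- apply/measurable_EFinP; apply: measurableT_comp => //.
  by apply: measurable_funM; [exact: H2'.1|exact: K2'.1].
- apply/measurable_EFinP; apply: measurable_funD; apply: measurable_funX;
    [exact: H2'.1|exact: K2'.1].
- move=> x _; rewrite lee_fin ler_norml.
  move: (grad P_ a H x) (grad P_ a K x) => u v.
  have := sqr_ge0 (u - v); have := sqr_ge0 (u + v).
  have := sqr_ge0 u; have := sqr_ge0 v.
  by move=> *; apply/andP; split; nra.
Qed.

Section bounded_derivative.
Variables (f psi : R -> R) (s : R).
Hypothesis f_Lip : Lip s f.
Hypothesis psi_Lip : Lip 2 psi.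
Hypothesis psis : forall x, `|psi x| <= s.
Hypothesis fpsi :
  forall x y, `|f x - f y - psi y * (x - y)| <= (x - y) ^+ 2.

Let fF_domD : domD P_ P (f \o F). Proof. exact: domD_Lip f_Lip F_domD. Qed.

Let fF2 : sqint P (f \o F). Proof. by apply/Lfun2P; case: fF_domD. Qed.

Let psiF2 : sqint P (psi \o F).
Proof.
apply: (sqint_Lip psi_Lip) => //; apply: measurableT_comp F2.1.
exact: Lip_measurable psi_Lip.
Qed.

Let c a : \bar R := (\int[P]_x (grad P_ a (f \o F) x * - grad P_ a LinvF x)%:E)%E.

Let c_summable : summable [set: A] c.
Proof.
apply: (@le_lt_trans _ _ (\esum_(a in [set: A])
    (energy P_ P a (f \o F) + energy P_ P a LinvF))%E).
  apply: le_esum => a _; apply: le_trans (integral_mul_grad_le a fF2 G2).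
  have := sqintM (sqint_grad P_prod a fF2) (sqintN (sqint_grad P_prod a G2)).
  move=> i; apply: le_trans (le_abse_integral P measurableT (measurable_int P i)) _.
  by rewrite le_eqVlt; apply/orP; left; apply/eqP; apply: eq_integral => x _;
    rewrite /= mulrN normrN.
rewrite esumD; do ?by move=> a _; exact: energy_ge0.
by apply: lte_add_pinfty; [exact: (domD_energy P_prod fF_domD)|exact: energy_Linv_lty].
Qed.

(* Integration by parts: [f \o F] is tested against [L (LinvF) = F]. *)
Let usum_c : usum c = (\int[P]_x (F x * f (F x))%:E)%E.
Proof.
case: LinvF_def => _ _ [_ _ /(_ _ fF_domD) cE].
have iDD a := sqintM (sqint_grad P_prod a fF2) (sqint_grad P_prod a G2).
pose e a := (\int[P]_x (grad P_ a (f \o F) x * grad P_ a LinvF x)%:E)%E.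
have cEe a : c a = (- e a)%E.
  by rewrite /e -integral_EFinN//; apply: eq_integral => x _; rewrite mulrN.
rewrite (_ : c = fun a => - e a)%E; last exact/funext.
rewrite usumN; last first.
  apply: le_lt_trans c_summable; apply: le_esum => a _.
  by rewrite cEe abseN.
rewrite (_ : usum e = 'E_P[fun x => ((f \o F) x * - F x)%R])%E; last first.
  by rewrite -cE; congr usum; apply/funext => a; rewrite unlock.
rewrite unlock -integral_EFinN//; last exact: (sqintM fF2 (sqintN F2)).
by apply: eq_integral => x _; congr EFin => /=; ring.
Qed.

Let measurable_exchange_pair a : measurable_fun setT (fun z : prod_space E * E a =>
  psi (F (upd z.1 a z.2)) * grad P_ a F z.1 * - grad P_ a LinvF z.1).
Proof.
apply: measurable_funM; first apply: measurable_funM.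
- exact: (@measurable_upd_pair _ _ _ E a (psi \o F) psiF2.1).
- exact: (measurableT_comp (sqint_grad P_prod a F2).1).
- apply: measurable_funN; exact: (measurableT_comp (sqint_grad P_prod a G2).1).
Qed.

Let measurable_exchange_term a : measurable_fun setT (exchange_term psi a).
Proof.
have mc : measurable_fun setT
    (fun z : prod_space E * prod_space E => (z.1, z.2 a)).
  apply: measurable_fun_pair => //.
  exact: (measurableT_comp (@measurable_coord _ _ E a) measurable_snd).
exact: (measurableT_comp (@measurable_exchange_pair a) mc).
Qed.

(** The bound on [psi] is decisive here: it leaves a product of two gradients, controlled by the
    summable energies of [F] and [LinvF]. *)
Let exchange_term_lty :
  (\esum_(a in [set: A]) \int[P \x P]_z `|exchange_term psi a z|%:E < +oo)%E.
Proof.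
have s0 : 0 <= s by apply: le_trans (psis 0).
apply: (@le_lt_trans _ _ (\esum_(a in [set: A])
    s%:E * (energy P_ P a F + energy P_ P a LinvF))%E).
  apply: le_esum => a _.
  apply: (@le_trans _ _ (s%:E *
      \int[P]_x `|grad P_ a F x * grad P_ a LinvF x|%:E)%E); last first.
    by rewrite lee_wpmul2l ?lee_fin//; exact: integral_mul_grad_le.
  have mg : measurable_fun setT (fun x => `|grad P_ a F x * grad P_ a LinvF x|).
    apply: measurableT_comp => //; apply: measurable_funM.
      exact: (sqint_grad P_prod a F2).1.
    exact: (sqint_grad P_prod a G2).1.
  rewrite -(ge0_integral_fst P P (g := fun x =>
    `|grad P_ a F x * grad P_ a LinvF x|%:E))//; last first.
    by apply/measurable_EFinP.
  rewrite -ge0_integralZl//; last first.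
    by apply/measurable_EFinP; exact: (measurableT_comp mg).
  apply: ge0_le_integral => //.
  - apply/measurable_EFinP; apply: measurableT_comp => //.
  - apply: measurable_funeM; apply/measurable_EFinP.
    exact: (measurableT_comp mg).
  - move=> z _; rewrite -EFinM lee_fin /exchange_term -mulrA normrM mulrN normrN.
    by rewrite ler_wpM2r.
rewrite esumZ//; last by move=> a; rewrite adde_ge0// energy_ge0.
rewrite esumD; do ?by move=> a _; exact: energy_ge0.
apply: lte_mul_pinfty; [by rewrite lee_fin|by []|].
by apply: lte_add_pinfty; [exact: (domD_energy P_prod F_domD)|exact: energy_Linv_lty].
Qed.

Let stein_exchange_integral a :
  (\int[P \x P]_z (exchange_term psi a z)%:E <= c a + remainder a)%E.
Proof.
have := stein_exchange P_prod a F2 G2 fF2.1 f_Lip psiF2.1 psis fpsi.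
rewrite -/(c a) -/(remainder a).
rewrite -(integral_indep_coord P_prod (a := a) (g := fun z =>
  (psi (F (upd z.1 a z.2)) * grad P_ a F z.1 * - grad P_ a LinvF z.1)%:E)); last first.
  exact/measurable_EFinP.
rewrite -[X in (`|_ - X|)%E]/(\int[P \x P]_z (exchange_term psi a z)%:E)%E.
have := summable_pinfty c_summable (x := a) I.
have := summable_pinfty (summable_integral_usum measurable_exchange_term
  exchange_term_lty) (x := a) I.
have := remainder_ge0 a.
case: (c a) => // u; case: (\int[P \x P]_z _)%E => // v.
case: (remainder a) => // [w|].
- rewrite -EFinB /= -EFinD !lee_fin ler_norml => _ _ _ /andP[]; lra.
- by move=> *; rewrite leey.
Qed.

Lemma stein_bound :
  (\int[P]_x (psi (F x) - F x * f (F x))%:E <=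
   \int[P \x P]_z ((psi (F z.1))%:E - usum (fun a => (exchange_term psi a z)%:E))
   + \esum_(a in [set: A]) remainder a)%E.
Proof.
have ipsi := sqint_integrable psiF2.
have iFf := sqintM F2 fF2.
rewrite integral_EFinB//.
have mpsi1 : measurable_fun setT
    (fun z : prod_space E * prod_space E => (psi (F z.1))%:E).
  by apply/measurable_EFinP; exact: (measurableT_comp psiF2.1).
rewrite (integralB measurableT _ (integrable_usum measurable_exchange_term
  exchange_term_lty)); last first.
  apply/integrableP; split => //.
  rewrite (ge0_integral_fst P P (g := fun x => `|(psi (F x))%:E|%E))//.
    by case/integrableP : ipsi.
  exact: (measurable_int P (integrable_abse ipsi)).
rewrite (integral_fst P P (g := fun x => (psi (F x))%:E)); last first.
  exact: (measurable_int P ipsi).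
rewrite integral_usum//.
rewrite -usum_c.
have bs := summable_integral_usum measurable_exchange_term exchange_term_lty.
have := le_usum bs c_summable remainder_ge0 stein_exchange_integral.
have := usum_fin_num bs; have := usum_fin_num c_summable.
have := integrable_fin_num measurableT ipsi; rewrite /comp.
case: (usum c) => // u; case: (usum _) => // v.
case: (\int[P]_x _)%E => // w _ _ _.
(* An infinite error sum makes the claim trivial; the other terms are all finite. *)
have : (0 <= \esum_(a in [set: A]) remainder a)%E by exact: esum_ge0.
case: (\esum_(a in _) _)%E => // [q _|_ _].
  by rewrite -!EFinN -!EFinD !lee_fin; lra.
by move=> *; rewrite leey.
Qed.

End bounded_derivative.

Let first_term (psi : R -> R) : \bar R :=
  (\int[P \x P]_z ((psi (F z.1))%:E - usum (fun a => (exchange_term psi a z)%:E)))%E.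

Let bound : \bar R := (ereal_sup [set first_term psi | psi in Lip 2]
  + \esum_(a in [set: A]) remainder a)%E.

Lemma integrable_Lip1_comp (phi : R -> R) : Lip 1 phi ->
  P.-integrable setT (EFin \o (phi \o F)).
Proof.
move=> phi1; apply: sqint_integrable; apply: (sqint_Lip phi1) => //.
by apply: measurableT_comp F2.1; exact: Lip_measurable phi1.
Qed.

Lemma Lip1_expectation_sub_le (phi : R -> R) : Lip 1 phi ->
  (\int[P]_x (phi (F x))%:E - \int[normal_prob 0 1]_x (phi x)%:E <= bound)%E.
Proof.
move=> phi1; have [m [g [mE gE g0]]] := Lip1_primitive phi1.
have [f [psi [fE psi2 psi4 fpsi]]] := stein_solution phi1 gE g0.
(* The constant 4 both bounds [psi] and is a Lipschitz constant of its primitive [f]. The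
   coefficient 1 in Taylor's formula, half the Lipschitz constant of [psi], gives the error sum its
   unit weight. *)
have f4 := is_derive1_le_Lip fE psi4.
have ftaylor x y : `|f x - f y - psi y * (x - y)| <= (x - y) ^+ 2.
  by have := @is_derive1_Taylor _ f psi y x 1 fE psi2; rewrite mul1r.
rewrite mE.
apply: (@le_trans _ _ (first_term psi + \esum_(a in [set: A]) remainder a)%E).
  apply: le_trans (stein_bound f4 psi2 psi4 ftaylor).
  rewrite le_eqVlt; apply/orP; left; apply/eqP.
  transitivity (\int[P]_x (phi (F x) - m)%:E)%E.
    rewrite (integral_EFinB (g := fun=> m)); first 1 last.
    - exact: integrable_Lip1_comp.
    - exact/sqint_integrable/sqint_cst.
    by rewrite integral_cst//= probability_setT mule1.
  by apply: eq_integral => x _; rewrite fpsi.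
by rewrite leeD2r//; apply: ereal_sup_ubound; exists psi.
Qed.

(** [Lip 1] is stable under negation even if [HH] is not, so the one-sided estimate applied to [phi]
    and to [- phi] yields the absolute value. *)
Lemma kappa_normal_le (HH : set (R -> R)) : HH `<=` Lip 1 ->
  (kappa HH (normal_prob 0 1) (distribution P F) <= bound)%E.
Proof.
move=> HH1; apply: ge_ereal_sup => _ [phi /HH1 phi1 <-].
have phiN1 : Lip 1 (\- phi).
  by move=> x y; rewrite /= -opprD normrN; exact: phi1.
rewrite integral_distribution; last 2 first.
- by apply/measurable_EFinP; exact: Lip_measurable phi1.
- exact: integrable_Lip1_comp phi1.
have := Lip1_expectation_sub_le phi1; have := Lip1_expectation_sub_le phiN1.
have i1 := integrable_Lip1_comp phi1.
have [m [_ [mE _ _]]] := Lip1_primitive phi1.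
rewrite [X in (_ - X <= _)%E -> _](_ : _ =
  - \int[normal_prob 0 1]_x (phi x)%:E)%E; last first.
  rewrite -integralN//; set phiE := (fun x => (phi x)%:E).
  have : (\int[normal_prob 0 1]_x phiE x)%E \is a fin_num by rewrite mE.
  rewrite [X in X \is a fin_num]integralE fin_numB => /andP[_ ?].
  by rewrite fin_num_adde_defl// fin_numN.
rewrite [X in (X - _ <= _)%E -> _](_ : _ = - \int[P]_x (phi (F x))%:E)%E; last first.
  exact: integral_EFinN.
rewrite mE; have := integrable_fin_num measurableT i1; rewrite /comp.
case: (\int[P]_x _)%E => // u _.
rewrite -!EFinN -!EFinD.
move: bound => [w| |]; [|by move=> _ _; rewrite leey|by rewrite leeNy_eq].
rewrite !lee_fin /= => ? ?.
by rewrite ler_norml; apply/andP; split; lra.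
Qed.

End Bound.

Theorem theorem5p10 (R : realType) (A : countType) (E : A -> ptopologicalType)
  (E_polish : forall a, polish R (E a))
  (P_ : forall a, probability (borel (E a)) R)
  (P : probability (prod_space (fun a => borel (E a))) R)
  (P_prod : is_product_prob P_ P)
  (HH : set (R -> R)) (HH_Lip1 : HH `<=` Lip 1)
  (F : {RV P >-> measurableTypeR R}) (F_domD : domD P_ P F)
  (F_centered : 'E_P[F]%E = 0%E)
  (LinvF : prod_space (fun a => borel (E a)) -> R)
  (LinvF_def : is_Linv P_ P F LinvF) :
  (kappa HH (normal_prob 0 1) (distribution P F)
   <= ereal_sup
        [set \int[P \x P]_z
               ((psi (F z.1))%:E
                - usum (fun a => (psi (F (upd z.1 a (z.2 a)))
                                  * grad P_ a F z.1
                                  * - grad P_ a LinvF z.1)%:E))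
        | psi in Lip 2]
      + \esum_(a in [set: A])
          \int[P]_x ((\int[P_ a]_y ((F x - F (upd x a y)) ^+ 2)%:E)
                     * `|grad P_ a LinvF x|%:E))%E.
Proof. exact: kappa_normal_le. Qed.
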